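(* Let $P,q\in\mathbb C(z)$ be rational functions with $P$ non-constant of degree $n$ and $q\not\equiv 0$, and let $\gamma\subset\mathbb C$ be a closed curve containing no poles of $P$ or $q$. Then for all $t\in U\cap U_\infty$ close enough to infinity the equality $$I_\infty(t)=\sum_{e=1}^r \mu(\gamma,z_e^P)\sum_{i\in J_e}\left(\frac{q}{P'}\right)\bigl(P_i^{-1}(t)\bigr)-\sum_{s=1}^l\mu(\gamma,z_s^q)\,\psi_s(t)+\frac{1}{2\pi\sqrt{-1}}\,\frac{1}{P(\infty)-t}\int_\gamma q(z)\,dz$$ holds.
   Context: A curve is an oriented piecewise-smooth curve in $\mathbb C$ having only transversal self-intersections. $U_\infty$ is the connected component of $\mathbb{CP}^1\setminus P(\gamma)$ containing $\infty$, and $I_\infty$ is the holomorphic function on $U_\infty$ given by $I_\infty(t)=\frac{1}{2\pi\sqrt{-1}}\int_\gamma\frac{q(z)\,dz}{P(z)-t}$. $C_P\subset\mathbb{CP}^1$ is the set of branch points of the algebraic function $P^{-1}$; $U\subset\mathbb C$ is a fixed simply connected domain with $U\cap C_P=\emptyset$ and $\infty\in\partial U$; $P_1^{-1},\dots,P_n^{-1}$ are the $n$ single-valued analytic branches of $P^{-1}$ in $U$. $z_1^P,\dots,z_r^P$ are the poles of $P$ in $\mathbb{CP}^1$. $J_e\subset\{1,\dots,n\}$ is the set of $i$ such that for $t$ close to infinity $P_i^{-1}(t)$ is close to $z_e^P$; that is, fixing small pairwise disjoint neighbourhoods $D_e$ of the points $z_e^P$, for $t\in U$ with $|t|$ large $J_e$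 is the set of $i$ with $P_i^{-1}(t)\in D_e$. $z_1^q,\dots,z_l^q$ are the finite poles of $q$; $q_s$ is the principal part of the Laurent series of $q$ at $z_s^q$; and $\psi_s(t)=\sum_{i=1}^n\left(\frac{q_s}{P'}\right)(P_i^{-1}(t))$ for $t\in U$. $\mu(\gamma,z)$ is the winding number of $\gamma$ about $z\in\mathbb{CP}^1\setminus\gamma$, with $\mu(\gamma,\infty)=0$. If $P(\infty)=\infty$, the term containing $\frac{1}{P(\infty)-t}$ is understood to be $0$. *)

(* Defs.v *)
From HB Require Import structures.
From mathcomp Require Import all_boot all_order all_algebra.
From mathcomp Require Import all_classical all_reals all_analysis.
From mathcomp Require Import complex fraction ring.

Set Implicit Arguments.
Unset Strict Implicit.
Unset Printing Implicit Defensive.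

Import Order.TTheory GRing.Theory Num.Theory.
Import numFieldNormedType.Exports.

Local Open Scope classical_set_scope.
Local Open Scope ring_scope.
Local Open Scope complex_scope.

(* R[i] carries its usual topology, the one of the modulus. *)
HB.instance Definition _ (R : realType) :=
  NormedModule.copy R[i] (R[i] : numClosedFieldType).

(* The Riemann sphere; [None] is the point at infinity. *)
Notation CP1 R := (one_point_compactification R[i]).
Notation ratfun F := {fraction {poly F}}.
Notation "x %:F" := (@FracField.tofrac _ x) : ring_scope.

Section RationalFunctions.
Variable F : fieldType.
Implicit Types (f P : ratfun F) (a c : F) (z : option F).

Definition rnum f : {poly F} :=
  let x := frac (repr f) in x.1 %/ gcdp x.1 x.2.
Definition rden f : {poly F} :=
  let x := frac (repr f) in x.2 %/ gcdp x.1 x.2.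

Definition rcst c : ratfun F := c%:P%:F.

Definition rdeg f : nat := (maxn (size (rnum f)) (size (rden f))).-1.

Definition reval f z : option F :=
  match z with
  | Some a =>
      if root (rden f) a then None else Some ((rnum f).[a] / (rden f).[a])
  | None =>
      if (size (rden f) < size (rnum f))%N then None
      else Some ((rnum f)`_(size (rden f)).-1 / lead_coef (rden f))
  end.

(* Value in [F], set to 0 at a pole. *)
Definition rval f z : F := odflt 0 (reval f z).

Definition rpoles f : set (option F) := [set z | reval f z = None].

Definition rderiv f : ratfun F :=
  ((rnum f)^`() * rden f - rnum f * (rden f)^`())%:F / (rden f ^+ 2)%:F.

(* Order of vanishing of [f != 0] at [z] (negative at a pole). *)
Definition rord f z : int :=
  match z with
  | Some a => (mup a (rnum f))%:Z - (mup a (rden f))%:Z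
  | None => (size (rden f))%:Z - (size (rnum f))%:Z
  end.

(* Ramification index of [P], as a self-map of the sphere, at [z]. *)
Definition ramification P z : int :=
  match reval P z with
  | Some c => rord (P - rcst c) z
  | None => - rord P z
  end.

Definition branch_points P : set (option F) :=
  reval P @` [set z | 1 < ramification P z].

(* The part with negative exponents of the Laurent series of [f] at [a]:
   [f] minus it has no pole at [a]. Existence and uniqueness are
   [principal_part_exists] and [is_principal_part_uniq]. *)
Definition is_principal_part f a (g : ratfun F) : Prop :=
  (exists m (c : 'I_m -> F),
     g = \sum_(k < m) rcst (c k) / (('X - a%:P)%:F) ^+ k.+1) /\
  reval (f - g) (Some a) <> None.

Definition principal_part f a : ratfun F := xget 0 (is_principal_part f a).

End RationalFunctions.

Lemma principal_part_step (K : fieldType) (N H X Y C g : K) :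
  X != 0 -> Y != 0 -> H != 0 ->
  (N * X + C * H) / (X * Y * H) - (g + C / (X * Y)) = N / (Y * H) - g.
Proof. by move=> X0 Y0 H0; field; rewrite X0 Y0 H0. Qed.

Lemma common_denominator (K : fieldType) (C X : K) (k M : nat) :
  X != 0 -> (k <= M)%N -> C / X ^+ k = C * X ^+ (M - k) / X ^+ M.
Proof.
move=> X0 lekM; apply/eqP; rewrite eqr_div ?expf_neq0 //.
by rewrite -mulrA -exprD subnK.
Qed.

Section RationalFunctionsTheory.
Variable F : fieldType.
Implicit Types (f g : ratfun F) (a : F) (A B : {poly F}).

Lemma rden_neq0 f : rden f != 0.
Proof.
rewrite /rden; case: (repr f) => -[n d] /= d0.
by rewrite divp_eq0 gcdp_eq0 (negPf d0) andbF /= -leqNgt leq_gcdpr.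
Qed.

Lemma coprime_rnum_rden f : coprimep (rnum f) (rden f).
Proof.
rewrite /rnum /rden; case: (repr f) => -[n d] /= d0.
by apply: coprimep_div_gcd; rewrite d0 orbT.
Qed.

Lemma rnum_rden f : f = (rnum f)%:F / (rden f)%:F.
Proof.
have e : f = (frac (repr f)).1%:F / (frac (repr f)).2%:F.
  rewrite -{1}[f]reprK -{1}[repr f]Ratio_numden.
  case: (repr f) => -[n d] /= d0.
  apply: (mulIf (x := d%:F)); first by rewrite tofrac_eq0.
  rewrite divfK ?tofrac_eq0 //; unlock FracField.tofrac.
  rewrite -[LHS]FracField.pi_mul; apply/eqmodP => /=.
  rewrite FracField.equivfE /FracField.mulf.
  rewrite !numden_Ratio ?mulf_neq0 ?oner_neq0 //.
  by rewrite !mulr1 mulrC.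
have d0 := denom_ratioP (repr f).
rewrite [LHS]e /rnum /rden.
set n := (frac _).1; set d := (frac _).2.
have g0 : (gcdp n d)%:F != 0 :> ratfun F.
  by rewrite tofrac_eq0 gcdp_eq0 (negPf d0) andbF.
have -> : n%:F / d%:F = (n %/ gcdp n d * gcdp n d)%:F /
    (d %/ gcdp n d * gcdp n d)%:F :> ratfun F.
  by rewrite (divpK (dvdp_gcdl n d)) (divpK (dvdp_gcdr n d)).
rewrite !tofracM invfM mulrACA divff ?mulr1 //.
Qed.

Lemma reval_frac A B a : ~~ root B a ->
  reval (A%:F / B%:F) (Some a) = Some (A.[a] / B.[a]).
Proof.
move=> Ba; set f := A%:F / B%:F.
have B0 : B != 0 by apply: contraNneq Ba => ->; rewrite root0.
have e : rnum f * B = A * rden f.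
  apply/eqP; rewrite -tofrac_eq !tofracM -eqr_div ?tofrac_eq0 ?rden_neq0 //.
  by rewrite -rnum_rden.
have da : ~~ root (rden f) a.
  apply: contra Ba; rewrite -!dvdp_XsubCl => /dvdp_trans; apply.
  have cop : coprimep (rden f) (rnum f).
    by rewrite coprimep_sym coprime_rnum_rden.
  by rewrite -(Gauss_dvdpr _ cop) e dvdp_mulIr.
rewrite /= (negPf da); congr Some; apply/eqP.
by rewrite eqr_div -?rootE // -!hornerM e.
Qed.

Lemma regularP f a : reval f (Some a) <> None <->
  exists A B, ~~ root B a /\ f = A%:F / B%:F.
Proof.
split=> [|[A [B [Ba ->]]]]; last by rewrite reval_frac.
rewrite /=; case: ifPn => // da _; exists (rnum f), (rden f).
by split=> //; exact: rnum_rden.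
Qed.

Lemma regularB f g a : reval f (Some a) <> None -> reval g (Some a) <> None ->
  reval (f - g) (Some a) <> None.
Proof.
move=> /regularP[A [B [Ba ->]]] /regularP[A' [B' [Ba' ->]]]; apply/regularP.
have nz p : ~~ root p a -> p%:F != 0 :> ratfun F.
  by rewrite tofrac_eq0; apply: contraNneq => ->; rewrite root0.
exists (A * B' - A' * B), (B * B'); split; first by rewrite rootM negb_or Ba.
by rewrite -mulNr addf_div ?nz // tofracB !tofracM mulNr.
Qed.

Lemma principal_part_exists f a : exists g, is_principal_part f a g.
Proof.
suff H : forall m N h, ~~ root h a ->
    exists g (c : nat -> F),
    g = \sum_(k < m) rcst (c k) / (('X - a%:P)%:F) ^+ k.+1 /\
    reval (N%:F / (('X - a%:P) ^+ m * h)%:F - g) (Some a) <> None.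
  have [m [h]] := multiplicity_XsubC (rden f) a; rewrite rden_neq0 /= => ha e.
  have [g [c [gE rg]]] := H m (rnum f) h ha.
  exists g; split; first by exists m, c.
  by rewrite {1}[f]rnum_rden e [h * _]mulrC.
have X0 : ('X - a%:P)%:F != 0 :> ratfun F by rewrite tofrac_eq0 polyXsubC_eq0.
elim=> [|m IHm] N h ha.
  exists 0, (fun=> 0); rewrite big_ord0 subr0 expr0 mul1r; split=> //.
  by apply/regularP; exists N, h.
pose c := N.[a] / h.[a].
have /factor_theorem[N' N'E] : root (N - c%:P * h) a.
  by rewrite rootE hornerD hornerN hornerM hornerC divfK ?subrr // -rootE.
have [g [c' [gE rg]]] := IHm N' h ha.
pose c'' k := if k == m then c else c' k.
exists (g + rcst c / ('X - a%:P)%:F ^+ m.+1), c''; split.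
  rewrite big_ord_recr /= {2}/c'' eqxx gE; congr (_ + _).
  by apply: eq_bigr => k _; rewrite /c'' ltn_eqF.
have h0 : h%:F != 0 :> ratfun F.
  by rewrite tofrac_eq0; apply: contraNneq ha => ->; rewrite root0.
suff -> : N%:F / (('X - a%:P) ^+ m.+1 * h)%:F -
  (g + rcst c / ('X - a%:P)%:F ^+ m.+1) = N'%:F / (('X - a%:P) ^+ m * h)%:F - g.
  by [].
have -> : N = N' * ('X - a%:P) + c%:P * h by rewrite -N'E subrK.
rewrite /rcst; move: ('X - a%:P) X0 => X X0.
rewrite !(tofracD, tofracM, tofracXn) exprS.
exact (@principal_part_step (ratfun F) _ _ _ (X%:F ^+ m) _ _
         X0 (expf_neq0 m X0) h0).
Qed.

Lemma is_principal_part_uniq f a g g' :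
  is_principal_part f a g -> is_principal_part f a g' -> g = g'.
Proof.
move=> [[m [c gE]] rg] [[m' [c' g'E]] rg'].
have X0 : ('X - a%:P)%:F != 0 :> ratfun F by rewrite tofrac_eq0 polyXsubC_eq0.
have polar m0 (c0 : 'I_m0 -> F) M : (m0 <= M)%N -> exists2 T : {poly F},
    \sum_(k < m0) rcst (c0 k) / (('X - a%:P)%:F) ^+ k.+1 =
      T%:F / (('X - a%:P) ^+ M)%:F & (size T <= M)%N.
  move=> lem; exists (\sum_(k < m0) (c0 k)%:P * ('X - a%:P) ^+ (M - k.+1)).
    rewrite raddf_sum /= mulr_suml; apply: eq_bigr => k _.
    have lek : (k.+1 <= M)%N by apply: leq_trans lem.
    rewrite tofracM !tofracXn.
    exact: (@common_denominator (ratfun F) _ _ _ _ X0 lek).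
  apply: (leq_trans (size_sum _ _ _)); apply/bigmax_leqP => k _.
  apply: (leq_trans (size_polyMleq _ _)); rewrite size_exp_XsubC addnS /=.
  have lek : (k.+1 <= M)%N by apply: leq_trans lem.
  have := size_polyC_leq1 (c0 k); rewrite -(leq_add2r (M - k.+1)).
  by move=> /leq_trans; apply; rewrite add1n -subSn // subSS leq_subr.
have [T TE sT] := polar m c _ (leq_maxl m m').
have [T' T'E sT'] := polar m' c' _ (leq_maxr m m').
set M := maxn m m' in sT sT' TE T'E.
have eg : g - g' = (T - T')%:F / (('X - a%:P) ^+ M)%:F.
  by rewrite tofracB mulrBl gE g'E TE T'E.
have := regularB rg' rg; have -> : f - g' - (f - g) = g - g'.
  by rewrite opprB addrC addrA addrNK.
rewrite eg => /regularP[A [B [Ba /eqP]]].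
have B0 : B != 0 by apply: contraNneq Ba => ->; rewrite root0.
have XM0 : ('X - a%:P) ^+ M != 0 :> {poly F}.
  by rewrite expf_neq0 ?polyXsubC_eq0.
rewrite eqr_div ?tofrac_eq0 // -!tofracM tofrac_eq => /eqP E.
have dv : ('X - a%:P) ^+ M %| T - T'.
  have cop : coprimep (('X - a%:P) ^+ M) B.
    by rewrite coprimep_expl // coprimep_sym coprimep_XsubC.
  by rewrite -(Gauss_dvdpl _ cop) E dvdp_mulIr.
have T0 : T - T' = 0.
  apply/eqP; apply: contraLR dv => T0; apply/negP => /(dvdp_leq T0).
  rewrite size_exp_XsubC ltnNge (leq_trans (size_polyD _ _)) //.
  by rewrite geq_max size_polyN sT.
by apply/eqP; rewrite -subr_eq0 eg T0 tofrac0 mul0r.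
Qed.

Lemma principal_partP f a : is_principal_part f a (principal_part f a).
Proof. exact: xgetPex (principal_part_exists f a). Qed.

End RationalFunctionsTheory.

Section Curves.
Variable R : realType.
Implicit Types (gamma v : R -> R[i]).

Definition velocity gamma (u : R) : R[i] :=
  derive1 (fun s => complex.Re (gamma s)) u
  +i* derive1 (fun s => complex.Im (gamma s)) u.

(* Regular and C^1 up to the endpoints: at [a] and [b] the value of [v] is the
   one-sided derivative of [gamma]. *)
Definition smooth_on (a b : R) gamma : Prop :=
  exists v,
    [/\ {within `[a, b], continuous v},
        forall u, u \in `[a, b] -> v u != 0 &
        forall u, u \in `]a, b[ ->
          [/\ derivable (fun s => complex.Re (gamma s)) u 1,
              derivable (fun s => complex.Im (gamma s)) u 1 &
              velocity gamma u = v u]].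

Definition piecewise_smooth gamma : Prop :=
  {within `[0, 1], continuous gamma} /\
  exists s : seq R, itv_partition 0 1 s /\
    forall i, (i < size s)%N ->
      smooth_on (nth 0 (0 :: s) i) (nth 0 (0 :: s) i.+1) gamma.

(* One-sided tangent vectors; they differ only at a corner. *)
Definition tangent gamma (u : R) (w : R[i]) : Prop :=
  (u < 1 /\ (h^-1)%:C * (gamma (u + h) - gamma u) @[h --> 0^'+] --> w) \/
  (0 < u /\ (h^-1)%:C * (gamma (u + h) - gamma u) @[h --> 0^'-] --> w).

(* [Im (w1 * w2^* ) != 0] says that w1 and w2 are independent over R; the
   closing point, reached at the parameters 0 and 1, is not counted as a
   self-intersection. At a corner both one-sided tangents are tested. *)
Definition transversal_self_intersections gamma : Prop :=
  forall s t : R, 0 <= s -> s < t -> t <= 1 -> gamma s = gamma t ->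
    ~ (s = 0 /\ t = 1) ->
  forall w1 w2, tangent gamma s w1 -> tangent gamma t w2 ->
    complex.Im (w1 * w2^*) != 0.

Definition closed_curve gamma : Prop :=
  [/\ piecewise_smooth gamma, transversal_self_intersections gamma &
      gamma 0 = gamma 1].

Definition contour_integral gamma (f : R[i] -> R[i]) : R[i] :=
  (\int[lebesgue_measure]_(u in `[0, 1])
     complex.Re (f (gamma u) * velocity gamma u))
  +i*
  (\int[lebesgue_measure]_(u in `[0, 1])
     complex.Im (f (gamma u) * velocity gamma u)).

Definition two_pi_i : R[i] := 0 +i* (2 * pi).

Definition winding gamma (z : CP1 R) : R[i] :=
  match z with
  | Some a => two_pi_i^-1 * contour_integral gamma (fun w => (w - a)^-1)
  | None => 0
  end.

Definition I_infty (P q : ratfun R[i]) gamma (t : R[i]) : R[i] :=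
  two_pi_i^-1 *
  contour_integral gamma (fun z => rval q (Some z) / (rval P (Some z) - t)).

Definition U_infty (P : ratfun R[i]) gamma : set (CP1 R) :=
  connected_component
    (~` [set (reval P (Some (gamma u)) : CP1 R) | u in `[0, 1]]) None.

End Curves.

Section Branches.
Variable R : realType.
Implicit Types (U : set R[i]) (P : ratfun R[i]).

Definition simply_connected U : Prop :=
  forall c : R -> R[i],
    {within `[0, 1], continuous c} -> c @` `[0, 1] `<=` U -> c 0 = c 1 ->
  exists H : R * R -> R[i],
    [/\ {within `[0, 1] `*` `[0, 1], continuous H},
        H @` (`[0, 1] `*` `[0, 1]) `<=` U,
        forall u, u \in `[0, 1] -> H (0, u) = c u /\ H (1, u) = c 0 &
        forall s, s \in `[0, 1] -> H (s, 0) = c 0 /\ H (s, 1) = c 0].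

Definition simply_connected_domain U : Prop :=
  [/\ U !=set0, open U, connected U & simply_connected U].

Definition boundary (T : topologicalType) (A : set T) : set T :=
  closure A `\` A°.

Definition sphere_inv (w : R[i]) : CP1 R := if w == 0 then None else Some w^-1.

(* Holomorphy of a map into the sphere, in the charts [w] and [1 / w]. *)
Definition holomorphic_at (phi : R[i] -> CP1 R) (t : R[i]) : Prop :=
  exists f : R[i] -> R[i],
    (\forall s \near t, derivable f s 1) /\
    ((\forall s \near t, phi s = Some (f s)) \/
     (\forall s \near t, phi s = sphere_inv (f s))).

(* The values at [t] form the whole fibre of [P]; when [n] is the degree and [t]
   is not a branch point they are pairwise distinct. A branch may take the value
   infinity, namely where [t] is the value of [P] at infinity. *)
Definition inverse_branches P U (n : nat) (phi : 'I_n -> R[i] -> CP1 R) :=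
  forall t, U t ->
    (forall i, holomorphic_at (phi i) t) /\
    [set z | reval P z = Some t] = range (phi ^~ t).

Definition psi P (qs : ratfun R[i]) (n : nat) (phi : 'I_n -> R[i] -> CP1 R)
    (t : R[i]) : R[i] :=
  \sum_(i < n) rval (qs / rderiv P) (phi i t).

End Branches.

(* Main.v *)
(* For [t] in [U] outside the branch points, with [t != P(oo)], the numerator
   of [P - t] has [n] simple roots, the points [p_i = P_i^-1(t)], so that
     1 / (P(z) - t) = k + \sum_i (1 / P'(p_i)) / (z - p_i),
   where [k = 1 / (P(oo) - t)], or [k = 0] when [P(oo) = oo]. Hence
     \int q / (P - t) = k \int q + \sum_i (1 / P'(p_i)) \int q(z) / (z - p_i).
   Expanding [q] into a polynomial plus its principal parts [q_s], all terms
   with a single-valued primitive drop out and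
     \int q(z) / (z - p) = 2 pi i (q(p) mu(p) - \sum_s q_s(p) mu(z_s)).
   Finally, for [t] large each [p_i] is so close to a pole [z_e] of [P] that
   [p_i] lies in [D_e] and [mu(p_i) = mu(z_e)]: the quotient
   [(z - p_i) / (z - z_e)], or [1 - z / p_i] when [z_e = oo], maps the curve into
   the right half-plane, where the logarithm is single-valued. *)
Require Import Defs.
From mathcomp Require Import all_boot all_order all_algebra.
From mathcomp Require Import all_classical all_reals all_analysis.
From mathcomp Require Import measurable_realfun.
From mathcomp Require Import complex fraction ring.

Set Implicit Arguments.
Unset Strict Implicit.
Unset Printing Implicit Defensive.

Import Order.TTheory GRing.Theory Num.Theory.
Import numFieldNormedType.Exports.

Local Open Scope classical_set_scope.
Local Open Scope ring_scope.
Local Open Scope complex_scope.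

(** * Contour integrals *)

Section PiecewiseIntegration.
Variable R : realType.
Local Notation mu := (@lebesgue_measure R).
Implicit Types (h F : R -> R) (a b : R).

(** Three features of the definitions shape the proof. At a corner [velocity] need not have a
    meaningful value, while the integrals run over the whole of [[0, 1]]; so integrands are
    controlled only inside the cells of a partition, whereas primitives are continuous across the
    corners and their increments telescope. [inverse_branches] gives each fibre as a set of values,
    but interpolation needs [n] distinct nodes. Distinctness is recovered by counting: the fibre
    polynomial has degree [n] and simple roots, and [n] values cover them. The bound on [|t|] must
    be uniform over the fibre. It comes from explicit growth estimates: off small discs around the
    finite poles, [|P|] is at most a constant times a power of [1 + |z|] whose exponent is the
    difference of the degrees of numerator and denominator. *)

Lemma itv_partition_nth_ind (cell Q : R -> R -> Prop) :
  (forall a, Q a a) ->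
  (forall a c b, a < c -> c <= b -> cell a c -> Q c b -> Q a b) ->
  forall a b s, itv_partition a b s ->
  (forall i, (i < size s)%N -> cell (nth 0 (a :: s) i) (nth 0 (a :: s) i.+1)) ->
  Q a b.
Proof.
move=> Qxx Qcat a b s; elim: s a => [|c s IHs] a.
  by move=> /itv_partition_nil <-.
move=> acs Hcell; have cs := itv_partition_cons acs.
apply: (Qcat a c) => //.
- by case: acs => /= /andP[].
- exact: itv_partition_le cs.
- exact: (Hcell 0%N).
- by apply: IHs => // i ilt; exact: (Hcell i.+1).
Qed.

(** The values of [h] at [a] and [b] are left free because the endpoints may be corners of the
    curve. *)
Definition extends_continuously h a b := exists2 k : R -> R,
  {within `[a, b], continuous k} & {in `]a, b[, h =1 k}.

(** [h] and [k] differ at most at two points of the segment, which affects neither measurability nor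
    the integral of the modulus. *)
Lemma extends_continuously_integrable h a b : a < b ->
  extends_continuously h a b -> mu.-integrable `[a, b] (EFin \o h).
Proof.
move=> ab [k kc hk].
have ki : mu.-integrable `[a, b] (EFin \o k).
  by apply: continuous_compact_integrable => //; exact: segment_compact.
have mh : measurable_fun `]a, b[ h.
  apply: (eq_measurable_fun k); first by move=> x; rewrite inE => /hk.
  by case/integrableP: ki => /measurable_EFinP + _;
    apply: measurable_funS => //; exact: subset_itv_oo_cc.
have mh' : measurable_fun `[a, b] (EFin \o h).
  by apply/measurable_EFinP; exact: measurable_fun_itv_cc mh.
apply/integrableP; split=> //; have /integrableP[mk] := ki.
congr (_ < _)%E.
transitivity (\int[mu]_(x in `[a, b]) (`|k x|)%:E)%E => //.
rewrite (@eq_integral_itv_bounded _ _ _ (fun x => `|h x|)) //.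
- by apply: measurableT_comp => //; apply: eq_measurable_fun mh => x; rewrite inE => /hk.
- exact: measurableT_comp.
- by move=> x /hk ->.
Qed.

Lemma integrable_setU (A B : set R) (f : R -> \bar R) :
  measurable A -> measurable B -> [disjoint A & B] ->
  mu.-integrable A f -> mu.-integrable B f -> mu.-integrable (A `|` B) f.
Proof.
move=> mA mB AB /integrableP[mf fA] /integrableP[mf' fB].
have mU : measurable_fun (A `|` B) f by apply/measurable_funU.
apply/integrableP; split=> //.
rewrite ge0_integral_setU //; first exact: lte_add_pinfty.
exact: measurableT_comp.
Qed.

Lemma itvcc_setU a c b : a <= c -> c <= b ->
  `[a, b]%classic = `[a, c]%classic `|` `]c, b]%classic :> set R.
Proof.
move=> ac cb; apply/seteqP; split=> x /=; rewrite !in_itv /=.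
  move=> /andP[ax xb]; rewrite ax xb; have [xc|cx] := leP x c; first by left.
  by right.
case=> /andP[H1 H2]; rewrite ?H1 ?H2 ?(le_trans H2 cb) //=.
by rewrite (le_trans ac (ltW H1)).
Qed.

Lemma disjoint_itvcc_oc a c b : [disjoint (`[a, c]%classic : set R) & `]c, b]%classic].
Proof.
apply/disj_setPS => x [] /=; rewrite !in_itv /= => /andP[_ xc] /andP[cx _].
by move: (lt_le_trans cx xc); rewrite ltxx.
Qed.

Lemma piecewise_integrable h a b s : itv_partition a b s ->
  (forall i, (i < size s)%N ->
     extends_continuously h (nth 0 (a :: s) i) (nth 0 (a :: s) i.+1)) ->
  mu.-integrable `[a, b] (EFin \o h).
Proof.
apply: (itv_partition_nth_ind
  (Q := fun a b => mu.-integrable `[a, b] (EFin \o h))).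
  move=> {}a; rewrite set_itv1; apply/integrableP; split.
    exact: measurable_fun_set1.
  by rewrite integral_set1.
move=> {}a c {}b ac cb hac hcb; rewrite (itvcc_setU (ltW ac) cb).
apply: integrable_setU => //; first exact: disjoint_itvcc_oc.
  exact: extends_continuously_integrable.
by apply: integrableS hcb => //; exact: subset_itv_oc_cc.
Qed.

(** Continuity of [F] across the breakpoints makes its increments telescope; at the breakpoints
    nothing is asked of its derivative. *)
Lemma piecewise_FTC h F a b s : itv_partition a b s ->
  {within `[a, b], continuous F} ->
  (forall i, (i < size s)%N ->
     let x := nth 0 (a :: s) i in let y := nth 0 (a :: s) i.+1 in
     extends_continuously h x y /\
     forall u, u \in `]x, y[ -> is_derive u (1 : R) F (h u)) ->
  \int[mu]_(u in `[a, b]) h u = F b - F a.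
Proof.
move=> ps cF H.
(* Integrability joins the conclusion so that the induction can use additivity of the integral over
   adjacent intervals. *)
suff : mu.-integrable `[a, b] (EFin \o h) /\
    \int[mu]_(u in `[a, b]) h u = F b - F a by case.
move: ps cF H => /[swap] cF ps H.
apply: (itv_partition_nth_ind
  (cell := fun x y => extends_continuously h x y /\
     forall u, u \in `]x, y[ -> is_derive u (1 : R) F (h u))
  (Q := fun a b => {within `[a, b], continuous F} ->
     mu.-integrable `[a, b] (EFin \o h) /\
     \int[mu]_(u in `[a, b]) h u = F b - F a) _ _ ps H cF).
  move=> {ps H cF}a _; rewrite set_itv1; split.
    apply/integrableP; split; first exact: measurable_fun_set1.
    by rewrite integral_set1.
  by rewrite subrr /Rintegral integral_set1.
move=> {s ps H cF} {}a c {}b ac cb [hac dF] IH cF.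
have sub1 : `[a, c] `<=` `[a, b] by apply: subset_itvl; rewrite bnd_simp.
have sub2 : `[c, b] `<=` `[a, b] by apply: subset_itvr; rewrite bnd_simp ltW.
have [hcb IHE] := IH (continuous_subspaceW sub2 cF).
have iac := extends_continuously_integrable ac hac.
have iab : mu.-integrable `[a, b] (EFin \o h).
  rewrite (itvcc_setU (ltW ac) cb).
  apply: integrable_setU => //; first exact: disjoint_itvcc_oc.
  by apply: integrableS hcb => //; exact: subset_itv_oc_cc.
split=> //; rewrite (itvcc_setU (ltW ac) cb) Rintegral_setU //; last first.
- exact: disjoint_itvcc_oc.
- by rewrite -itvcc_setU // ltW.
rewrite Rintegral_itv_obnd_cbnd; last first.
  by apply: integrableS hcb => //; exact: subset_itv_oc_cc.
rewrite IHE.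
have [k kc hk] := hac.
have -> : \int[mu]_(x in `[a, c]) h x = F c - F a; last first.
  by rewrite addrC addrA subrK.
have mh : measurable_fun `]a, c[ h.
  by case/integrableP: iac => /measurable_EFinP + _;
    apply: measurable_funS => //; exact: subset_itv_oo_cc.
have mk : measurable_fun `]a, c[ k.
  by apply: (eq_measurable_fun h) mh => x; rewrite inE => /hk.
(* [h] is uncontrolled at the ends of the cell, so it is exchanged for the continuous [k] under the
   integral. *)
rewrite /Rintegral (eq_integral_itv_bounded _ _ mh mk hk).
rewrite (continuous_FTC2 ac kc (F := F)) //.
- have /continuous_within_itvP-/(_ ac)[_ Fa Fc] := continuous_subspaceW sub1 cF.
  by split=> // u /dF [].
- by move=> u uac; rewrite derive1E -hk //; case: (dF u uac).
Qed.
End PiecewiseIntegration.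

(** * Calculus of complex-valued functions of a real variable *)

Section ComplexValuedDerivative.
Variable R : realType.
Implicit Types (g h : R -> R[i]) (u : R) (d e : R[i]).

(** The variable is real and the values are complex, so differentiation is componentwise; the rules
    below restore complex algebra on [d]. *)
Definition cderive g u d :=
  is_derive u (1 : R) (fun s => complex.Re (g s)) (complex.Re d) /\
  is_derive u (1 : R) (fun s => complex.Im (g s)) (complex.Im d).

Lemma cderive_eq g u d e : cderive g u d -> d = e -> cderive g u e.
Proof. by move=> + <-. Qed.

Lemma cderive_cst (c : R[i]) u : cderive (fun=> c) u 0.
Proof. by split; exact: is_derive_cst. Qed.

Lemma complex_ReD (x y : R[i]) : complex.Re (x + y) = complex.Re x + complex.Re y.
Proof. by case: x; case: y. Qed.
Lemma complex_ImD (x y : R[i]) : complex.Im (x + y) = complex.Im x + complex.Im y.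
Proof. by case: x; case: y. Qed.
Lemma complex_ReM (x y : R[i]) : complex.Re (x * y) =
  complex.Re x * complex.Re y - complex.Im x * complex.Im y.
Proof. by case: x; case: y. Qed.
Lemma complex_ImM (x y : R[i]) : complex.Im (x * y) =
  complex.Re x * complex.Im y + complex.Im x * complex.Re y.
Proof. by case: x; case: y. Qed.

Lemma complex_ReN (x : R[i]) : complex.Re (- x) = - complex.Re x.
Proof. by case: x. Qed.
Lemma complex_ImN (x : R[i]) : complex.Im (- x) = - complex.Im x.
Proof. by case: x. Qed.

Lemma complex_eqP (x y : R[i]) :
  complex.Re x = complex.Re y -> complex.Im x = complex.Im y -> x = y.
Proof. by case: x y => [a b] [c e] /= -> ->. Qed.

Lemma cderiveD g h u d e : cderive g u d -> cderive h u e ->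
  cderive (fun s => g s + h s) u (d + e).
Proof.
move=> [gr gi] [hr hi]; split; rewrite ?complex_ReD ?complex_ImD.
  by under eq_fun do rewrite complex_ReD; exact: is_deriveD.
by under eq_fun do rewrite complex_ImD; exact: is_deriveD.
Qed.

Lemma cderive_subr g u d e : cderive g u d -> cderive (fun s => g s - e) u d.
Proof.
move=> dg; apply: cderive_eq (cderiveD dg (cderive_cst (- e) u)) _.
by rewrite addr0.
Qed.

Lemma cderiveM g h u d e : cderive g u d -> cderive h u e ->
  cderive (fun s => g s * h s) u (d * h u + g u * e).
Proof.
move=> [gr gi] [hr hi]; split.
  under eq_fun do rewrite complex_ReM.
  apply: (is_derive_eq (is_deriveB (is_deriveM gr hr) (is_deriveM gi hi))).
  by rewrite !(complex_ReD, complex_ReM) /GRing.scale /=; ring.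
under eq_fun do rewrite complex_ImM.
apply: (is_derive_eq (is_deriveD (is_deriveM gr hi) (is_deriveM gi hr))).
by rewrite !(complex_ImD, complex_ImM) /GRing.scale /=; ring.
Qed.

Lemma cderiveX g u d n : cderive g u d ->
  cderive (fun s => g s ^+ n) u (n%:R * g u ^+ n.-1 * d).
Proof.
move=> gd; elim: n => [|n IHn].
  by rewrite !mul0r; exact: cderive_cst.
under eq_fun do rewrite exprS.
apply: (cderive_eq (cderiveM gd IHn)) => /=.
case: n {IHn} => [|n]; first by rewrite !expr0 !mul0r mulr0 addr0 mulr1 !mul1r.
by rewrite /= exprS -[n.+2]addn1 natrD; ring.
Qed.

(** An element of [R], unlike the norm of [R[i]], so that real logarithms and extreme values apply
    to it. *)
Definition sqnorm (z : R[i]) : R := complex.Re z ^+ 2 + complex.Im z ^+ 2.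

Lemma sqnorm_gt0 (z : R[i]) : z != 0 -> 0 < sqnorm z.
Proof.
case: z => a b; rewrite eq_complex /= negb_and /sqnorm /= => ab.
rewrite lt_neqAle addr_ge0 ?sqr_ge0 // andbT eq_sym.
by rewrite paddr_eq0 ?sqr_ge0 // !sqrf_eq0 negb_and.
Qed.

Lemma complex_ReV (z : R[i]) : complex.Re z^-1 = complex.Re z / sqnorm z.
Proof. by case: z. Qed.
Lemma complex_ImV (z : R[i]) : complex.Im z^-1 = - (complex.Im z / sqnorm z).
Proof. by case: z. Qed.

Lemma is_derive_sqnorm g u d : cderive g u d ->
  is_derive u (1 : R) (fun s => sqnorm (g s))
    (2 * (complex.Re (g u) * complex.Re d + complex.Im (g u) * complex.Im d)).
Proof.
move=> [gr gi]; rewrite /sqnorm.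
apply: (is_derive_eq (is_deriveD (is_deriveX 2 gr) (is_deriveX 2 gi))).
by rewrite /GRing.scale /= !expr1; ring.
Qed.

Lemma cderiveV g u d : g u != 0 -> cderive g u d ->
  cderive (fun s => (g s)^-1) u (- (g u ^- 2) * d).
Proof.
move=> gu0 gd; have := is_derive_sqnorm gd; case: (gd) => gr gi sd.
have s0 : sqnorm (g u) != 0 by rewrite gt_eqF ?sqnorm_gt0.
have sV := is_deriveV (f := fun s => sqnorm (g s)) s0 sd.
have -> : - g u ^- 2 * d = - ((g u)^-1 * (g u)^-1 * d).
  by rewrite expr2 invfM mulNr.
split.
  under eq_fun do rewrite complex_ReV.
  apply: (is_derive_eq (is_deriveM gr sV)).
  rewrite complex_ReN !(complex_ReM, complex_ImM, complex_ReV, complex_ImV); move: s0; rewrite /sqnorm.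
  case: (g u) d gr gi sd sV gd => a b [d e] _ _ _ _ _ /= s0.
  by rewrite /GRing.scale /=; field.
under eq_fun do rewrite complex_ImV.
apply: (is_derive_eq (is_deriveN (is_deriveM gi sV))).
rewrite complex_ImN !(complex_ReM, complex_ImM, complex_ReV, complex_ImV); move: s0; rewrite /sqnorm.
case: (g u) d gr gi sd sV gd => a b [d e] _ _ _ _ _ /= s0.
by rewrite /GRing.scale /=; field.
Qed.

(* The principal branch of the logarithm on the right half-plane. *)
Definition clog (z : R[i]) : R[i] :=
  (ln (sqnorm z) / 2) +i* atan (complex.Im z / complex.Re z).

(** Positivity of the real part serves both components: the argument of [ln] is positive, and
    [Im / Re] has a nonzero denominator. *)
Lemma cderive_clog g u d : 0 < complex.Re (g u) -> cderive g u d ->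
  cderive (fun s => clog (g s)) u (d / g u).
Proof.
move=> gu0 gd; have := is_derive_sqnorm gd; case: (gd) => gr gi sd.
have re0 : complex.Re (g u) != 0 by rewrite gt_eqF.
have s0 : 0 < sqnorm (g u).
  by apply: sqnorm_gt0; apply: contraNneq re0 => ->.
split=> /=.
  have ld := is_derive1_comp (f := @ln R) (g := fun s => sqnorm (g s))
    (is_derive1_ln s0) sd.
  have cd := is_derive_cst (2^-1 : R) u (1 : R).
  apply: (is_derive_eq (is_deriveM ld cd)).
  rewrite complex_ReM complex_ReV complex_ImV; move: s0 => /lt0r_neq0; rewrite /sqnorm.
  case: (g u) d gr gi sd ld gd gu0 re0 => a b [d e] _ _ _ _ _ _ /= re0 s0.
  by rewrite /GRing.scale /=; field.
have qd := is_deriveM gi (is_deriveV (f := fun s => complex.Re (g s)) re0 gr).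
have ad := is_derive1_comp (f := @atan R)
  (g := fun s => complex.Im (g s) / complex.Re (g s)) (is_derive1_atan _) qd.
apply: (is_derive_eq ad).
rewrite complex_ImM complex_ReV complex_ImV; move: s0 => /lt0r_neq0; rewrite /sqnorm.
case: (g u) d gr gi sd gd qd ad gu0 re0 => a b [d e] _ _ _ _ _ _ _ /= re0 s0.
by rewrite /GRing.scale /=; field; rewrite s0 re0.
Qed.

Lemma Re_continuous : continuous (@complex.Re R : R[i] -> R).
Proof.
move=> x; apply/(@cvgrPdist_lt R R _ (nbhs x)) => e e0.
have e0' : 0 < e%:C by rewrite ltcR.
have := nbhsx_ballx x _ e0'; apply: filterS => y /=.
rewrite -ball_normE /= -ltcR; apply: le_lt_trans.
by have := normc_ge_Re (x - y); case: x; case: y.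
Qed.

Lemma normc_ge_Im (z : R[i]) : `|complex.Im z|%:C <= `|z|.
Proof.
by rewrite normc_def lecR -sqrtr_sqr ler_wsqrtr // lerDr sqr_ge0.
Qed.

Lemma Im_continuous : continuous (@complex.Im R : R[i] -> R).
Proof.
move=> x; apply/(@cvgrPdist_lt R R _ (nbhs x)) => e e0.
have e0' : 0 < e%:C by rewrite ltcR.
have := nbhsx_ballx x _ e0'; apply: filterS => y /=.
rewrite -ball_normE /= -ltcR; apply: le_lt_trans.
by have := normc_ge_Im (x - y); case: x; case: y.
Qed.

Lemma within_Re (A : set R) g :
  {within A, continuous g} -> {within A, continuous (fun u => complex.Re (g u))}.
Proof.
by move=> gc x; apply: (continuous_comp (gc x)); exact: Re_continuous.
Qed.

Lemma within_Im (A : set R) g :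
  {within A, continuous g} -> {within A, continuous (fun u => complex.Im (g u))}.
Proof.
by move=> gc x; apply: (continuous_comp (gc x)); exact: Im_continuous.
Qed.

Lemma within_sqnorm (A : set R) g :
  {within A, continuous g} -> {within A, continuous (fun u => sqnorm (g u))}.
Proof.
move=> gc; have cr := within_Re gc; have ci := within_Im gc.
under eq_fun do rewrite /sqnorm !expr2.
by move=> x; apply: cvgD; apply: cvgM; first [exact: cr | exact: ci].
Qed.

End ComplexValuedDerivative.

(** * Linearity of contour integrals, and primitives *)

Section ContourIntegrals.
Variable R : realType.
Local Notation mu := (@lebesgue_measure R).
Variable gamma : R -> R[i].
Hypothesis gamma_pws : piecewise_smooth gamma.
Implicit Types (f g : R[i] -> R[i]) (a w : R[i]).

Definition continuous_along f := {within `[0, 1], continuous (f \o gamma)}.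

Lemma continuous_along_id : continuous_along id.
Proof. by case: gamma_pws. Qed.

Lemma continuous_along_cst a : continuous_along (fun=> a).
Proof. by move=> x; exact: cvg_cst. Qed.

Lemma continuous_alongD f g : continuous_along f -> continuous_along g ->
  continuous_along (fun z => f z + g z).
Proof. by move=> cf cg x; apply: cvgD; [exact: cf | exact: cg]. Qed.

Lemma continuous_alongM f g : continuous_along f -> continuous_along g ->
  continuous_along (fun z => f z * g z).
Proof. by move=> cf cg x; apply: cvgM; [exact: cf | exact: cg]. Qed.

Lemma continuous_alongZ a f : continuous_along f ->
  continuous_along (fun z => a * f z).
Proof.
by move=> cf; apply: continuous_alongM cf; exact: continuous_along_cst.
Qed.

Lemma continuous_alongX f n : continuous_along f ->
  continuous_along (fun z => f z ^+ n).
Proof.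
move=> cf; elim: n => [|n IHn]; first exact: continuous_along_cst.
rewrite (_ : (fun _ => _) = fun z => f z * f z ^+ n); last first.
  by apply/funext => z; rewrite exprS.
exact: continuous_alongM.
Qed.

Lemma eq_continuous_along f g : continuous_along f ->
  (forall u, u \in `[0, 1] -> f (gamma u) = g (gamma u)) ->
  continuous_along g.
Proof.
move=> cf fg; apply: subspace_eq_continuous cf => u; rewrite inE /= => u01.
exact: fg.
Qed.

Lemma continuous_alongV f : continuous_along f ->
  (forall u, u \in `[0, 1] -> f (gamma u) != 0) ->
  continuous_along (fun z => (f z)^-1).
Proof.
move=> cf f0; rewrite /continuous_along continuous_subspace_in => u.
rewrite inE /= => u01.
by apply: cvgV; [exact: f0 | exact: cf].
Qed.

Lemma continuous_along_sum (I : Type) (r : seq I) (F : I -> R[i] -> R[i]) :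
  (forall i, continuous_along (F i)) ->
  continuous_along (fun z => \sum_(i <- r) F i z).
Proof.
move=> cF; elim: r => [|i r IHr].
  apply: (@eq_continuous_along (fun=> 0)) => [|u _].
    exact: continuous_along_cst.
  by rewrite big_nil.
apply: (eq_continuous_along (continuous_alongD (cF i) IHr)) => u _.
by rewrite big_cons.
Qed.

Lemma smooth_piece_derivative : exists s, itv_partition 0 1 s /\
  forall i, (i < size s)%N ->
    let x := nth 0 (0 :: s) i in let y := nth 0 (0 :: s) i.+1 in
    [/\ `[x, y] `<=` (`[0, 1] : set R),
      (exists2 v, {within `[x, y], continuous v} &
        {in `]x, y[, velocity gamma =1 v}) &
      forall u, u \in `]x, y[ -> cderive gamma u (velocity gamma u)].
Proof.
have [_ [s [ps sm]]] := gamma_pws; exists s; split=> // i ilt x y.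
split.
- have x0 : 0 <= x.
    rewrite /x (set_nth_default 1); last exact: ltnW.
    by apply: itv_partition_nth_ge ps; exact: ltnW.
  have y1 : y <= 1.
    by rewrite /y (set_nth_default 1) //; apply: itv_partition_nth_le ps.
  move=> u /=; rewrite !in_itv /= => /andP[xu uy].
  by rewrite (le_trans x0 xu) (le_trans uy y1).
- by have [v [cv _ Hv]] := sm i ilt; exists v => // u /Hv[].
- have [v [_ _ Hv]] := sm i ilt => u /Hv[dr di _]; rewrite /velocity !derive1E.
  by split; exact: derivableP.
Qed.

(** [proj] is the real or the imaginary part, so that one argument serves both components. *)
Lemma extends_continuously_integrand (proj : R[i] -> R) f x y :
  continuous proj -> continuous_along f -> `[x, y] `<=` (`[0, 1] : set R) ->
  (exists2 v, {within `[x, y], continuous v} &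
     {in `]x, y[, velocity gamma =1 v}) ->
  extends_continuously (fun u => proj (f (gamma u) * velocity gamma u)) x y.
Proof.
move=> cproj cf sub [v cv Ev].
exists (fun u => proj (f (gamma u) * v u)); last first.
  by move=> u /Ev /= ->.
have cfxy := continuous_subspaceW sub cf.
have cfv : {within `[x, y], continuous (fun u => f (gamma u) * v u)}.
  by move=> u; apply: cvgM; [exact: cfxy | exact: cv].
by move=> u; apply: (continuous_comp (cfv u)); exact: cproj.
Qed.

Lemma integrable_along (proj : R[i] -> R) f :
  continuous proj -> continuous_along f ->
  mu.-integrable `[0, 1]
    (EFin \o (fun u => proj (f (gamma u) * velocity gamma u))).
Proof.
move=> cproj cf; have [s [ps Hs]] := smooth_piece_derivative.
suff H : forall i, (i < size s)%N -> extends_continuously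
    (fun u => proj (f (gamma u) * velocity gamma u))
    (nth 0 (0 :: s) i) (nth 0 (0 :: s) i.+1).
  exact: (piecewise_integrable ps H).
move=> i ilt; have [sub Ev _] := Hs i ilt.
exact: (extends_continuously_integrand cproj cf sub Ev).
Qed.

Lemma eq_contour_integral f g :
  (forall u, u \in `[0, 1] -> f (gamma u) = g (gamma u)) ->
  contour_integral gamma f = contour_integral gamma g.
Proof.
move=> fg; rewrite /contour_integral; congr (_ +i* _);
  by apply: eq_Rintegral => u; rewrite inE /= => /fg ->.
Qed.

Lemma contour_integralD f g : continuous_along f -> continuous_along g ->
  contour_integral gamma (fun z => f z + g z) =
  contour_integral gamma f + contour_integral gamma g.
Proof.
move=> cf cg.
have H (proj : R[i] -> R) : continuous proj -> {morph proj : x y / x + y} ->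
    \int[mu]_(u in `[0, 1]) proj ((f (gamma u) + g (gamma u)) * velocity gamma u) =
    \int[mu]_(u in `[0, 1]) proj (f (gamma u) * velocity gamma u) +
    \int[mu]_(u in `[0, 1]) proj (g (gamma u) * velocity gamma u).
  move=> cp mp; have i1 := integrable_along cp cf.
  have i2 := integrable_along cp cg.
  rewrite -(RintegralD _ i1 i2) //.
  by apply: eq_Rintegral => u _; rewrite mulrDl mp.
by rewrite /contour_integral (H _ (@Re_continuous R) (@complex_ReD R))
  (H _ (@Im_continuous R) (@complex_ImD R)).
Qed.

(** A complex factor mixes the components, so each component of the result needs the integrability
    of both. *)
Lemma contour_integralZ a f : continuous_along f ->
  contour_integral gamma (fun z => a * f z) = a * contour_integral gamma f.
Proof.
move=> cf.
have ir := integrable_along (@Re_continuous R) cf.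
have ii := integrable_along (@Im_continuous R) cf.
have Zi (h : R -> R) k : mu.-integrable `[0, 1] (EFin \o h) ->
    mu.-integrable `[0, 1] (EFin \o (fun u => k * h u)).
  move=> ih; have : mu.-integrable `[0, 1] (fun u => k%:E * (h u)%:E)%E.
    exact: integrableZl.
  by [].
apply: complex_eqP.
  rewrite complex_ReM /=.
  rewrite -(RintegralZl _ _ ir) // -(RintegralZl _ _ ii) // -RintegralB //;
    try exact: Zi.
  by apply: eq_Rintegral => u _; rewrite -mulrA complex_ReM.
rewrite complex_ImM /=.
rewrite -(RintegralZl _ _ ir) // -(RintegralZl _ _ ii) // -RintegralD //;
  try exact: Zi.
by apply: eq_Rintegral => u _; rewrite -mulrA complex_ImM.
Qed.

Lemma contour_integral_sum (I : Type) (r : seq I) (F : I -> R[i] -> R[i]) :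
  (forall i, continuous_along (F i)) ->
  contour_integral gamma (fun z => \sum_(i <- r) F i z) =
  \sum_(i <- r) contour_integral gamma (F i).
Proof.
move=> cF; elim: r => [|i r IHr].
  rewrite big_nil -[RHS](mul0r (contour_integral gamma (fun=> 0))).
  rewrite -contour_integralZ; last exact: continuous_along_cst.
  by apply: eq_contour_integral => u _; rewrite big_nil mul0r.
rewrite big_cons -IHr -contour_integralD //; last exact: continuous_along_sum.
by apply: eq_contour_integral => u _; rewrite big_cons.
Qed.

(** The primitive lives on the parameter interval and not in the plane, which admits a logarithm
    along the curve. Its derivative is required only where [gamma] has one. *)
Lemma contour_integral_primitive f (F : R -> R[i]) : continuous_along f ->
  {within `[0, 1], continuous (fun u => complex.Re (F u))} ->
  {within `[0, 1], continuous (fun u => complex.Im (F u))} ->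
  (forall u, u \in `[0, 1] -> cderive gamma u (velocity gamma u) ->
     cderive F u (f (gamma u) * velocity gamma u)) ->
  contour_integral gamma f = F 1 - F 0.
Proof.
move=> cf cr ci dF; have [s [ps Hs]] := smooth_piece_derivative.
apply: complex_eqP.
  rewrite complex_ReD complex_ReN /contour_integral /=.
  apply: (piecewise_FTC ps cr) => i ilt; have [sub Ev dg] := Hs i ilt; split.
    exact: extends_continuously_integrand (@Re_continuous R) cf sub Ev.
  move=> u uxy; have /dF /(_ (dg _ uxy))[] // : u \in `[0, 1].
  by apply: sub => /=; exact: subset_itv_oo_cc uxy.
rewrite complex_ImD complex_ImN /contour_integral /=.
apply: (piecewise_FTC ps ci) => i ilt; have [sub Ev dg] := Hs i ilt; split.
  exact: extends_continuously_integrand (@Im_continuous R) cf sub Ev.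
move=> u uxy; have /dF /(_ (dg _ uxy))[] // : u \in `[0, 1].
by apply: sub => /=; exact: subset_itv_oo_cc uxy.
Qed.

End ContourIntegrals.

(** * Vanishing integrals and stability of winding numbers *)

Section ClosedCurves.
Variable R : realType.
Variable gamma : R -> R[i].
Hypothesis gamma_pws : piecewise_smooth gamma.
Hypothesis gamma_closed : gamma 0 = gamma 1.
Implicit Types (f g : R[i] -> R[i]) (a w : R[i]).
Local Notation continuous_along := (continuous_along gamma).

Lemma contour_integral_exact f g : continuous_along f -> continuous_along g ->
  (forall u, u \in `[0, 1] -> cderive gamma u (velocity gamma u) ->
     cderive (fun s => g (gamma s)) u (f (gamma u) * velocity gamma u)) ->
  contour_integral gamma f = 0.
Proof.
move=> cf cg dg.
rewrite (contour_integral_primitive gamma_pws cf (within_Re cg) (within_Im cg) dg).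
by rewrite /= gamma_closed subrr.
Qed.

Lemma contour_integral_exprn n : contour_integral gamma (fun z => z ^+ n) = 0.
Proof.
have cX k : continuous_along (fun z => z ^+ k).
  exact: continuous_alongX (continuous_along_id gamma_pws).
apply: (contour_integral_exact (g := fun z => n.+1%:R^-1 * z ^+ n.+1)).
- exact: cX.
- by apply: continuous_alongM (cX _); exact: continuous_along_cst.
- move=> u _ dg.
  apply: cderive_eq (cderiveM (cderive_cst _ u) (cderiveX n.+1 dg)) _.
  by rewrite mul0r add0r !mulrA mulVf ?mul1r // pnatr_eq0.
Qed.

Lemma continuous_along_subV a : (forall u, u \in `[0, 1] -> gamma u != a) ->
  continuous_along (fun z => (z - a)^-1).
Proof.
move=> ga; apply: continuous_alongV => [|u /ga]; last by rewrite subr_eq0.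
by apply: continuous_alongD; [exact: continuous_along_id | exact: continuous_along_cst].
Qed.

(** The exponent is at least 2, so a negative power is a primitive; exponent 1 would be the winding
    integral. *)
Lemma contour_integral_subV_exprn a n :
  (forall u, u \in `[0, 1] -> gamma u != a) ->
  contour_integral gamma (fun z => (z - a)^-1 ^+ n.+2) = 0.
Proof.
move=> ga; have cX k : continuous_along (fun z => (z - a)^-1 ^+ k).
  exact: continuous_alongX (continuous_along_subV ga).
apply: (contour_integral_exact
  (g := fun z => - n.+1%:R^-1 * (z - a)^-1 ^+ n.+1)).
- exact: cX.
- by apply: continuous_alongM (cX _); exact: continuous_along_cst.
- move=> u u01 dg; have nz : gamma u - a != 0 by rewrite subr_eq0 ga.
  have dV := cderiveV (g := fun s => gamma s - a) nz (cderive_subr a dg).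
  apply: cderive_eq (cderiveM (cderive_cst _ u) (cderiveX n.+1 dV)) _.
  rewrite mul0r add0r !mulrA /= mulNr mulVf ?pnatr_eq0 // -exprVn.
  by rewrite !exprS expr0; ring.
Qed.

(** Along the curve [clog (g (gamma u))] is a primitive, and it takes equal values at both ends
    because it depends only on the point [gamma u]. *)
Lemma contour_integral_dlog g g' : continuous_along g -> continuous_along g' ->
  (forall u, u \in `[0, 1] -> 0 < complex.Re (g (gamma u))) ->
  (forall u, u \in `[0, 1] -> cderive gamma u (velocity gamma u) ->
     cderive (fun s => g (gamma s)) u (g' (gamma u) * velocity gamma u)) ->
  contour_integral gamma (fun z => g' z / g z) = 0.
Proof.
move=> cg cg' g_gt0 dg.
have g0 u : u \in `[0, 1] -> g (gamma u) != 0.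
  by move=> /g_gt0; apply: contraTneq => ->; rewrite ltxx.
have cf : continuous_along (fun z => g' z / g z).
  exact: continuous_alongM cg' (continuous_alongV cg g0).
rewrite (contour_integral_primitive gamma_pws cf
  (F := fun u => clog (g (gamma u)))) ?gamma_closed ?subrr //=.
- have cs := within_sqnorm cg; rewrite continuous_subspace_in => u.
  rewrite inE /= => u01; apply: cvgM; last exact: cvg_cst.
  apply: (continuous_comp (cs u)); apply: continuous_ln.
  exact: sqnorm_gt0 (g0 _ u01).
- have cr := within_Re cg; have ci := within_Im cg.
  have cq : {within `[0, 1], continuous (fun u =>
      complex.Im (g (gamma u)) / complex.Re (g (gamma u)))}.
    rewrite continuous_subspace_in => u; rewrite inE /= => u01.
    apply: cvgM; first exact: ci.
    by apply: cvgV; [rewrite gt_eqF ?g_gt0 | exact: cr].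
  by move=> u; apply: (continuous_comp (cq u)); exact: continuous_atan.
- move=> u u01 /(dg _ u01) dgu.
  apply: cderive_eq (cderive_clog (g_gt0 _ u01) dgu) _.
  by rewrite mulrAC.
Qed.

Lemma Re_gt0_near1 (z : R[i]) : `|1 - z| < 1 -> 0 < complex.Re z.
Proof.
move=> z1; have := le_lt_trans (normc_ge_Re _) z1; rewrite ltcR.
move=> /(le_lt_trans (ler_norm _)); case: z {z1} => x y /=.
by rewrite ltrBlDr -ltrBlDl subrr.
Qed.

(** For [g = (z - w) / (z - a)] one has [1 - g = (w - a) / (z - a)], so the hypothesis says exactly
    that [g] stays in the open unit disc about 1. *)
Lemma winding_near a w :
  (forall u, u \in `[0, 1] -> `|w - a| < `|gamma u - a|) ->
  winding gamma (Some w) = winding gamma (Some a).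
Proof.
move=> H.
have ga u : u \in `[0, 1] -> gamma u != a.
  by move=> /H; apply: contraTneq => ->; rewrite subrr normr0 normr_lt0.
have gw u : u \in `[0, 1] -> gamma u != w.
  by move=> /H; apply: contraTneq => ->; rewrite ltxx.
have cid := continuous_along_id gamma_pws.
have ca := continuous_along_subV ga; have cw := continuous_along_subV gw.
pose g z := (z - w) * (z - a)^-1.
have cg : continuous_along g.
  apply: continuous_alongM ca; apply: continuous_alongD cid _.
  exact: continuous_along_cst.
have cd : continuous_along (fun z => (z - w)^-1 + (- 1) * (z - a)^-1).
  apply: continuous_alongD cw _; apply: continuous_alongM ca.
  exact: continuous_along_cst.
rewrite /winding; congr (_ * _).
have cNa : continuous_along (fun z => (- 1) * (z - a)^-1).
  by apply: continuous_alongM ca; exact: continuous_along_cst.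
apply/eqP; rewrite -subr_eq0 -[- contour_integral _ _]mulN1r.
rewrite -(contour_integralZ gamma_pws _ ca).
rewrite -(contour_integralD gamma_pws cw cNa).
(* Written as logarithmic derivative times [g], so that [g' / g] collapses to the difference of the
   two winding integrands. *)
pose g' z := ((z - w)^-1 + (- 1) * (z - a)^-1) * g z.
rewrite (eq_contour_integral (g := fun z => g' z / g z)); last first.
  move=> u u01; rewrite /g' mulfK // mulf_neq0 ?invr_eq0 ?subr_eq0 ?ga ?gw //.
have cg' : continuous_along g' by exact: continuous_alongM cd cg.
apply/eqP/(contour_integral_dlog cg cg').
  move=> u u01; apply: Re_gt0_near1; rewrite /g.
  have nz : gamma u - a != 0 by rewrite subr_eq0 ga.
  have -> : 1 - (gamma u - w) / (gamma u - a) = (w - a) / (gamma u - a).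
    by field.
  by rewrite normrM normfV ltr_pdivrMr ?normr_gt0 // mul1r H.
move=> u u01 dg.
have nz : gamma u - a != 0 by rewrite subr_eq0 ga.
have nz' : gamma u - w != 0 by rewrite subr_eq0 gw.
have dV := cderiveV (g := fun s => gamma s - a) nz (cderive_subr a dg).
apply: cderive_eq (cderiveM (cderive_subr w dg) dV) _.
by rewrite /g' /g; field; rewrite nz nz'.
Qed.

(** [1 / (z - w)] is the logarithmic derivative of [1 - z / w], which stays in the unit disc about 1
    since [|z / w| < 1] on the curve. *)
Lemma winding_far w :
  (forall u, u \in `[0, 1] -> `|gamma u| < `|w|) -> winding gamma (Some w) = 0.
Proof.
move=> H.
have gw u : u \in `[0, 1] -> gamma u != w.
  by move=> /H; apply: contraTneq => ->; rewrite ltxx.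
have w0 : w != 0.
  apply/eqP => w0; have /H : (0 : R) \in `[0, 1] by rewrite in_itv /= lexx ler01.
  by rewrite w0 normr0 normr_lt0.
have cid := continuous_along_id gamma_pws.
have ccst c : continuous_along (fun=> c) by exact: continuous_along_cst.
pose g z := 1 + (- w^-1) * z.
have cg : continuous_along g.
  exact: continuous_alongD (ccst _) (continuous_alongM (ccst _) cid).
rewrite /winding (eq_contour_integral (g := fun z => (- w^-1) / g z)); last first.
  move=> u u01; rewrite /g.
  have nz : gamma u - w != 0 by rewrite subr_eq0 gw.
  have nz' : w - gamma u != 0 by rewrite subr_eq0 eq_sym gw.
  have -> : 1 + - w^-1 * gamma u = (w - gamma u) / w by field.
  by field; rewrite nz nz' w0.
rewrite (contour_integral_dlog cg (ccst (- w^-1))) ?mulr0 //.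
  move=> u u01; apply: Re_gt0_near1; rewrite /g mulNr opprD addrA subrr add0r.
  rewrite opprK normrM normfV mulrC ltr_pdivrMr ?normr_gt0 // mul1r.
  exact: H.
move=> u u01 dg.
have dM := cderiveM (cderive_cst (- w^-1) u) dg.
apply: cderive_eq (cderiveD (cderive_cst 1 u) dM) _.
by rewrite add0r mul0r add0r.
Qed.

End ClosedCurves.

(** * Cauchy integrals of partial fractions *)

Section CauchyFormula.
Variable R : realType.
Variable gamma : R -> R[i].
Hypothesis gamma_pws : piecewise_smooth gamma.
Hypothesis gamma_closed : gamma 0 = gamma 1.
Implicit Types (f g : R[i] -> R[i]) (a p w : R[i]).
Local Notation continuous_along := (continuous_along gamma).
Local Notation ci := (contour_integral gamma).
Local Notation off w := (forall u, u \in `[0, 1] -> gamma u != w).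

(** Induction on [z^(n+1) / (z - p) = z^n + p z^n / (z - p)], whose first summand has a
    primitive. *)
Lemma contour_integral_exprn_quot p n : off p ->
  ci (fun z => z ^+ n / (z - p)) = p ^+ n * ci (fun z => (z - p)^-1).
Proof.
move=> gp; have cp := continuous_along_subV gamma_pws gp.
have cX k : continuous_along (fun z => z ^+ k).
  exact: continuous_alongX (continuous_along_id gamma_pws).
elim: n => [|n IHn].
  by rewrite mul1r; apply: eq_contour_integral => u _; rewrite mul1r.
have cq : continuous_along (fun z => z ^+ n / (z - p)).
  exact: continuous_alongM (cX n) cp.
rewrite exprS -mulrA -IHn -(contour_integralZ gamma_pws _ cq).
rewrite -[RHS]add0r -(contour_integral_exprn gamma_pws gamma_closed n).
rewrite -(contour_integralD gamma_pws (cX n)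
  (continuous_alongZ cq)).
apply: eq_contour_integral => u u01.
have nz : gamma u - p != 0 by rewrite subr_eq0 gp.
by rewrite exprS; field.
Qed.

(** Splitting [1 / ((z - a) (z - p))] trades one power of [1 / (z - a)] for a factor [1 / (p - a)],
    and leaves a pure power of [1 / (z - a)]. That power integrates to 0 except at the last
    splitting, where its exponent is 1. *)
Lemma contour_integral_subV_exprn_quot a p n : off a -> off p -> p != a ->
  ci (fun z => (z - a)^-1 ^+ n.+1 / (z - p)) =
  (p - a)^-1 ^+ n.+1 * (ci (fun z => (z - p)^-1) - ci (fun z => (z - a)^-1)).
Proof.
move=> ga gp pa; have cp := continuous_along_subV gamma_pws gp.
have ca := continuous_along_subV gamma_pws ga.
have cX k : continuous_along (fun z => (z - a)^-1 ^+ k).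
  exact: continuous_alongX ca.
have pa0 : p - a != 0 by rewrite subr_eq0.
have split_quot u : u \in `[0, 1] -> (gamma u - a)^-1 / (gamma u - p) =
    (p - a)^-1 * ((gamma u - p)^-1 + (- 1) * (gamma u - a)^-1).
  move=> u01.
  have nz : gamma u - p != 0 by rewrite subr_eq0 gp.
  have nz' : gamma u - a != 0 by rewrite subr_eq0 ga.
  by field; rewrite nz nz' pa0.
elim: n => [|n IHn].
  rewrite !expr1 -[- ci _]mulN1r -(contour_integralZ gamma_pws _ ca).
  rewrite -(contour_integralD gamma_pws cp (continuous_alongZ ca)).
  rewrite -(contour_integralZ gamma_pws _ (continuous_alongD cp (continuous_alongZ ca))).
  by apply: eq_contour_integral => u u01; rewrite expr1 split_quot.
have cq : continuous_along (fun z => (z - a)^-1 ^+ n.+1 / (z - p)).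
  exact: continuous_alongM (cX _) cp.
(* The pure power of exponent [n + 2] is inserted as a zero summand, so that both sides become
   integrals of equal integrands. *)
rewrite exprS -mulrA -IHn -[ci (fun z => _ ^+ n.+1 / _)]addr0.
rewrite -(mulr0 (- 1 : R[i])).
rewrite -(contour_integral_subV_exprn gamma_pws gamma_closed n ga).
rewrite -(contour_integralZ gamma_pws _ (cX n.+2)).
rewrite -(contour_integralD gamma_pws cq (continuous_alongZ (cX n.+2))).
rewrite -(contour_integralZ gamma_pws _ (continuous_alongD cq (continuous_alongZ (cX n.+2)))).
apply: eq_contour_integral => u u01.
rewrite exprSr -mulrA split_quot //.
by ring.
Qed.

Variables (d : nat) (b : nat -> R[i]).
Variables (l : nat) (zq : 'I_l -> R[i]) (m : 'I_l -> nat) (c : 'I_l -> nat -> R[i]).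

(** Models the values of [q_s]; the coefficients stay abstract, so the integrals below do not
    mention rational functions. *)
Definition polar (s : 'I_l) z := \sum_(k < m s) c s k * (z - zq s)^-1 ^+ k.+1.

Definition partial_fraction_sum z := \sum_(k < d) b k * z ^+ k + \sum_(s < l) polar s z.

Hypothesis off_zq : forall s, off (zq s).

Lemma continuous_along_polar s : continuous_along (polar s).
Proof.
apply: continuous_along_sum => k; apply: continuous_alongM.
  exact: continuous_along_cst.
exact: continuous_alongX (continuous_along_subV gamma_pws (off_zq s)).
Qed.

Lemma continuous_along_partial_fraction_sum : continuous_along partial_fraction_sum.
Proof.
apply: continuous_alongD; apply: continuous_along_sum.
  move=> k; apply: continuous_alongM; first exact: continuous_along_cst.
  exact: continuous_alongX (continuous_along_id gamma_pws).
by move=> s; exact: continuous_along_polar.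
Qed.

Lemma contour_integral_polar_quot s p : off p -> p != zq s ->
  ci (fun z => polar s z / (z - p)) =
  polar s p * (ci (fun z => (z - p)^-1) - ci (fun z => (z - zq s)^-1)).
Proof.
move=> gp ps; have cp := continuous_along_subV gamma_pws gp.
have cq k : continuous_along (fun z => (z - zq s)^-1 ^+ k.+1 / (z - p)).
  apply: continuous_alongM cp.
  exact: continuous_alongX (continuous_along_subV gamma_pws (off_zq s)).
rewrite (eq_contour_integral (g := fun z => \sum_(k < m s)
  c s k * ((z - zq s)^-1 ^+ k.+1 / (z - p)))); last first.
  by move=> u _; rewrite mulr_suml; apply: eq_bigr => k _; rewrite mulrA.
have ccq (k : 'I_(m s)) : continuous_along
    (fun z => c s k * ((z - zq s)^-1 ^+ k.+1 / (z - p))).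
  exact: continuous_alongZ (cq k).
rewrite (contour_integral_sum gamma_pws _ ccq).
rewrite mulr_suml; apply: eq_bigr => k _.
rewrite (contour_integralZ gamma_pws _ (cq k)).
by rewrite (contour_integral_subV_exprn_quot _ (off_zq s) gp ps) !mulrA.
Qed.

Lemma contour_integral_partial_fractions_quot p : off p -> (forall s, p != zq s) ->
  ci (fun z => partial_fraction_sum z / (z - p)) =
  partial_fraction_sum p * ci (fun z => (z - p)^-1) -
  \sum_(s < l) polar s p * ci (fun z => (z - zq s)^-1).
Proof.
move=> gp ps; have cp := continuous_along_subV gamma_pws gp.
have cX k : continuous_along (fun z => z ^+ k / (z - p)).
  apply: continuous_alongM cp.
  exact: continuous_alongX (continuous_along_id gamma_pws).
have cbX (k : 'I_d) : continuous_along (fun z => b k * (z ^+ k / (z - p))).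
  exact: continuous_alongZ (cX k).
have cP s : continuous_along (fun z => polar s z / (z - p)).
  exact: continuous_alongM (@continuous_along_polar s) cp.
rewrite (eq_contour_integral (g := fun z =>
  \sum_(k < d) b k * (z ^+ k / (z - p)) +
  \sum_(s < l) polar s z / (z - p))); last first.
  move=> u _; rewrite /partial_fraction_sum mulrDl !mulr_suml; congr (_ + _).
  by apply: eq_bigr => k _; rewrite mulrA.
rewrite (contour_integralD gamma_pws
  (continuous_along_sum cbX) (continuous_along_sum cP)).
rewrite (contour_integral_sum gamma_pws _ cbX) (contour_integral_sum gamma_pws _ cP).
rewrite /partial_fraction_sum mulrDl -addrA !mulr_suml; congr (_ + _).
  apply: eq_bigr => k _; rewrite (contour_integralZ gamma_pws _ (cX k)).
  by rewrite (contour_integral_exprn_quot _ gp) !mulrA.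
rewrite -sumrB; apply: eq_bigr => s _.
by rewrite (contour_integral_polar_quot gp (ps s)) mulrBr.
Qed.

(** The factor [k + ...] is the shape that [1 / (P - t)] takes after interpolation at the fibre. *)
Lemma contour_integral_partial_fractions_sum (n : nat) (k : R[i]) (al p : 'I_n -> R[i]) :
  (forall i, off (p i)) -> (forall i s, p i != zq s) ->
  ci (fun z => partial_fraction_sum z * (k + \sum_(i < n) al i / (z - p i))) =
  k * ci partial_fraction_sum +
  \sum_(i < n) al i * (partial_fraction_sum (p i) * ci (fun z => (z - p i)^-1) -
    \sum_(s < l) polar s (p i) * ci (fun z => (z - zq s)^-1)).
Proof.
move=> gp ps; have cE := continuous_along_partial_fraction_sum.
have cp i : continuous_along (fun z => partial_fraction_sum z / (z - p i)).
  exact: continuous_alongM cE (continuous_along_subV gamma_pws (gp i)).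
have cap i : continuous_along (fun z => al i * (partial_fraction_sum z / (z - p i))).
  exact: continuous_alongZ (cp i).
have ckE : continuous_along (fun z => k * partial_fraction_sum z).
  exact: continuous_alongZ cE.
rewrite (eq_contour_integral (g := fun z => k * partial_fraction_sum z +
  \sum_(i < n) al i * (partial_fraction_sum z / (z - p i)))); last first.
  move=> u _; rewrite mulrDr [_ * k]mulrC mulr_sumr; congr (_ + _).
  by apply: eq_bigr => i _; rewrite mulrCA.
rewrite (contour_integralD gamma_pws ckE (continuous_along_sum cap)).
rewrite (contour_integralZ gamma_pws _ cE) (contour_integral_sum gamma_pws _ cap).
congr (_ + _); apply: eq_bigr => i _.
rewrite (contour_integralZ gamma_pws _ (cp i)).
by rewrite (contour_integral_partial_fractions_quot (gp i) (ps i)).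
Qed.

End CauchyFormula.

(** * Rational functions *)

Section RationalFunctionValues.
Variable F : fieldType.
Implicit Types (f g : ratfun F) (a z c : F) (A B p : {poly F}).

Definition regular f a := reval f (Some a) <> None.

Lemma nroot_neq0 B a : ~~ root B a -> B != 0.
Proof. by apply: contraNneq => ->; rewrite root0. Qed.

Lemma rval_frac A B a : ~~ root B a ->
  rval (A%:F / B%:F) (Some a) = A.[a] / B.[a].
Proof. by move=> Ba; rewrite /rval reval_frac. Qed.

(** Regularity accompanies every value because [rval] is 0 at a pole, where additivity can fail. *)
Lemma regularD f g a : regular f a -> regular g a ->
  regular (f + g) a /\ rval (f + g) (Some a) = rval f (Some a) + rval g (Some a).
Proof.
move=> /regularP[A [B [Ba ->]]] /regularP[A' [B' [Ba' ->]]].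
have BB : ~~ root (B * B') a by rewrite rootM negb_or Ba.
have -> : A%:F / B%:F + A'%:F / B'%:F = (A * B' + A' * B)%:F / (B * B')%:F.
  by rewrite addf_div ?tofrac_eq0 ?(nroot_neq0 Ba) ?(nroot_neq0 Ba') //
    tofracD !tofracM.
split; first by apply/regularP; exists (A * B' + A' * B), (B * B').
rewrite !rval_frac // addf_div -?rootE //.
by rewrite !hornerE.
Qed.

Lemma regularM f g a : regular f a -> regular g a ->
  regular (f * g) a /\ rval (f * g) (Some a) = rval f (Some a) * rval g (Some a).
Proof.
move=> /regularP[A [B [Ba ->]]] /regularP[A' [B' [Ba' ->]]].
have BB : ~~ root (B * B') a by rewrite rootM negb_or Ba.
have -> : A%:F / B%:F * (A'%:F / B'%:F) = (A * A')%:F / (B * B')%:F.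
  by rewrite mulf_div !tofracM.
split; first by apply/regularP; exists (A * A'), (B * B').
by rewrite !rval_frac // mulf_div !hornerE.
Qed.

Lemma regularV f a : regular f a -> rval f (Some a) != 0 ->
  regular f^-1 a /\ rval f^-1 (Some a) = (rval f (Some a))^-1.
Proof.
move=> /regularP[A [B [Ba ->]]]; rewrite rval_frac // mulf_eq0 negb_or -rootE.
move=> /andP[Aa _]; rewrite invf_div.
split; first by apply/regularP; exists B, A.
by rewrite rval_frac // invf_div.
Qed.

Lemma regular_poly p a : regular p%:F a /\ rval p%:F (Some a) = p.[a].
Proof.
have E : p%:F = p%:F / 1%:F :> ratfun F by rewrite tofrac1 divr1.
have r1 : ~~ root (1 : {poly F}) a by rewrite rootC oner_eq0.
split; first by apply/regularP; exists p, 1.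
by rewrite E rval_frac // hornerE divr1.
Qed.

Lemma regular_sum (I : Type) (r : seq I) (f : I -> ratfun F) a :
  (forall i, regular (f i) a) -> regular (\sum_(i <- r) f i) a /\
  rval (\sum_(i <- r) f i) (Some a) = \sum_(i <- r) rval (f i) (Some a).
Proof.
move=> rf; elim: r => [|i r [rr IHr]].
  have [r0 v0] := regular_poly 0 a; rewrite !big_nil.
  by rewrite -tofrac0 v0 horner0.
by have [rD vD] := regularD (rf i) rr; rewrite !big_cons vD IHr.
Qed.

Lemma regular_polar_term c a n z : z != a ->
  regular (rcst c / ('X - a%:P)%:F ^+ n) z /\
  rval (rcst c / ('X - a%:P)%:F ^+ n) (Some z) = c * (z - a)^-1 ^+ n.
Proof.
move=> za; rewrite -tofracXn.
have r0 : ~~ root (('X - a%:P) ^+ n) z.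
  by rewrite rootE horner_exp hornerXsubC expf_neq0 // subr_eq0.
split; first by apply/regularP; exists c%:P, (('X - a%:P) ^+ n).
by rewrite rval_frac // hornerC horner_exp hornerXsubC exprVn.
Qed.

(** Coefficients are reindexed from ['I_m] to [nat], so that the data of different poles share one
    type and can be chosen simultaneously. *)
Lemma principal_part_expansion f a : exists (m : nat) (c : nat -> F),
  forall z, z != a -> regular (principal_part f a) z /\
    rval (principal_part f a) (Some z) = \sum_(k < m) c k * (z - a)^-1 ^+ k.+1.
Proof.
have [[m [c E]] _] := principal_partP f a.
exists m, (fun k => if insub k is Some i then c i else 0) => z za.
have H (k : 'I_m) := regular_polar_term (c k) k.+1 za.
rewrite E; have [rS ->] := regular_sum (index_enum _) (fun k => (H k).1).
split=> //; apply: eq_bigr => k _; rewrite (H k).2.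
by case: insubP => [i _ /val_inj -> //|]; rewrite ltn_ord.
Qed.

(** Removing from [B] a multiple of [Q] and the Lagrange terms leaves a polynomial of size at most
    [n] with [n] distinct roots, hence zero. The constant term is the value of [B / Q] at
    infinity. *)
Lemma lagrange_partial_fractions (n : nat) (B Q : {poly F}) (p : 'I_n -> F) z :
  size Q = n.+1 -> (size B <= n.+1)%N -> injective p ->
  (forall i, root Q (p i)) -> (forall i, Q^`().[p i] != 0) -> Q.[z] != 0 ->
  B.[z] / Q.[z] = B`_n / Q`_n + \sum_(i < n) B.[p i] / Q^`().[p i] / (z - p i).
Proof.
move=> sQ sB pinj rQ dQ Qz.
(* The Lagrange basis before normalisation: [L i] vanishes at the other nodes and equals the
   derivative of [Q] at [p i]. *)
pose L i := Q %/ ('X - (p i)%:P).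
have QE i : Q = L i * ('X - (p i)%:P) by rewrite divpK // dvdp_XsubCl.
have Q0 : Q != 0 by rewrite -size_poly_gt0 sQ.
have L0 i : L i != 0.
  by move: Q0; rewrite (QE i); apply: contraNneq => ->; rewrite mul0r.
have Lii i : (L i).[p i] = Q^`().[p i].
  by rewrite (QE i) derivM derivXsubC !hornerE subrr mulr0 add0r.
have Lij i j : i != j -> (L i).[p j] = 0.
  move=> ij; have /eqP := rQ j; rewrite (QE i) hornerM hornerXsubC => /eqP.
  rewrite mulf_eq0 => /orP[/eqP //|]; rewrite subr_eq0 => /eqP /pinj ji.
  by rewrite ji eqxx in ij.
have sL i : size (L i) = n.
  have := sQ; rewrite (QE i) size_Mmonic ?monicXsubC // size_XsubC.
  by rewrite addnC => -[].
have Qn0 : Q`_n != 0.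
  by have := lead_coef_eq0 Q; rewrite /lead_coef sQ (negPf Q0) /= => ->.
pose W := B - (B`_n / Q`_n) *: Q - \sum_(i < n) (B.[p i] / Q^`().[p i]) *: L i.
have sW : (size W <= n)%N.
  rewrite (leq_trans (size_polyD _ _)) // geq_max; apply/andP; split.
    apply/leq_sizeP => j; rewrite leq_eqVlt => /orP[/eqP <-|nj].
      by rewrite coefB coefZ divfK // subrr.
    rewrite coefB coefZ [Q`_j]nth_default ?sQ // mulr0 subr0.
    by rewrite nth_default // (leq_trans sB).
  rewrite size_polyN; apply: (leq_trans (size_sum _ _ _)).
  by apply/bigmax_leqP => i _; rewrite (leq_trans (size_scale_leq _ _)) ?sL.
have W0 : W = 0.
  apply: (@roots_geq_poly_eq0 _ _ (codom p)).
  - apply/allP => _ /codomP[j ->]; rewrite rootE !hornerE horner_sum.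
    have /eqP -> := rQ j; rewrite mulr0 subr0 (bigD1 j) //= big1 ?addr0.
      by rewrite hornerZ Lii divfK // subrr.
    by move=> i ij; rewrite hornerZ Lij ?mulr0 // eq_sym.
  - by rewrite map_inj_uniq // enum_uniq.
  - by rewrite size_codom card_ord.
have : W.[z] = 0 by rewrite W0 horner0.
rewrite !hornerE horner_sum => /eqP; rewrite subr_eq0 subr_eq addrC => /eqP ->.
rewrite mulrDl mulfK // ; congr (_ + _); rewrite mulr_suml.
apply: eq_bigr => i _; rewrite hornerZ -!mulrA; do 2 congr (_ * _).
have Qzi : Q.[z] = (L i).[z] * (z - p i) by rewrite [in LHS](QE i) hornerM hornerXsubC.
have : Q.[z] != 0 by []; rewrite Qzi mulf_eq0 negb_or => /andP[l0 z0].
by rewrite invfM mulrA mulfV // mul1r.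
Qed.

End RationalFunctionValues.

(** * Partial fractions over an algebraically closed field *)

Section PartialFractions.
Variable F : closedFieldType.
Implicit Types (f g : ratfun F) (a z c : F) (A B p : {poly F}).

(** Over a closed field a denominator without roots is constant. *)
Lemma regular_everywhere f : (forall a, regular f a) -> exists p, f = p%:F.
Proof.
move=> rf; have [->|] := eqVneq f 0; first by exists 0; rewrite tofrac0.
move=> _; have : size (rden f) == 1%N.
  apply: contraT => /closed_rootP[a ra].
  by have := rf a; rewrite /regular /= ra.
move=> /size_poly1P[c c0 E]; exists (c^-1 *: rnum f).
rewrite {1}[f]rnum_rden E; apply: (canLR (mulfK _)).
  by rewrite tofrac_eq0 polyC_eq0.
by rewrite -tofracM -scalerAl mulrC mul_polyC scalerA mulVf ?scale1r.
Qed.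

(** The difference with the principal parts has no finite pole: at [s i] one of them cancels the
    pole and the others are regular; elsewhere every term is regular. *)
Lemma partial_fraction_expansion f (l : nat) (s : 'I_l -> F) : injective s ->
  (forall z, ~ regular f z -> exists i, s i = z) ->
  exists p, f = p%:F + \sum_(i < l) principal_part f (s i).
Proof.
move=> sinj spoles.
have regN g a : regular g a -> regular (- g) a.
  move=> rg; rewrite -sub0r; apply: regularB => //.
  by rewrite -tofrac0; case: (regular_poly (0 : {poly F}) a).
have rpp i a : a != s i -> regular (principal_part f (s i)) a.
  by move=> ai; have [m [c H]] := principal_part_expansion f (s i); case: (H a ai).
suff [p E] : exists p, f - \sum_(i < l) principal_part f (s i) = p%:F.
  by exists p; rewrite -E subrK.
apply: regular_everywhere => a.
have [[i ai]|na] := pselect (exists i, s i = a); last first.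
  apply: regularB; first by apply: contrapT => /spoles.
  by apply: (regular_sum _ _).1 => i; apply: rpp; apply/eqP => ai; case: na; exists i.
rewrite (bigD1 i) //= opprD addrA; apply: regularB.
  by rewrite -ai; case: (principal_partP f (s i)).
rewrite big_mkcond; apply: (regular_sum _ _).1 => j.
case: ifP => [ji|_].
  by apply: rpp; rewrite -ai; apply: contraNneq ji => /sinj ->.
by rewrite -tofrac0; case: (regular_poly (0 : {poly F}) a).
Qed.

(** The same coefficients describe [f] and its principal parts, which ties [psi] to the integrals of
    the polar terms. *)
Lemma rval_expansion f (l : nat) (s : 'I_l -> F) : injective s ->
  (forall z, ~ regular f z -> exists i, s i = z) ->
  exists p (m : 'I_l -> nat) (c : 'I_l -> nat -> F),
    (forall i z, z != s i -> rval (principal_part f (s i)) (Some z) =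
       \sum_(k < m i) c i k * (z - s i)^-1 ^+ k.+1) /\
    (forall z, (forall i, z != s i) -> rval f (Some z) = p.[z] +
       \sum_(i < l) \sum_(k < m i) c i k * (z - s i)^-1 ^+ k.+1).
Proof.
move=> sinj spoles; have [p E] := partial_fraction_expansion sinj spoles.
have H i : exists mc : nat * (nat -> F), forall z, z != s i ->
    regular (principal_part f (s i)) z /\
    rval (principal_part f (s i)) (Some z) =
      \sum_(k < mc.1) mc.2 k * (z - s i)^-1 ^+ k.+1.
  by have [m [c Hmc]] := principal_part_expansion f (s i); exists (m, c).
have [mc Hmc] := choice H.
exists p, (fun i => (mc i).1), (fun i => (mc i).2).
split=> [i z zi|z zs]; first by case: (Hmc i z zi).
have [rp vp] := regular_poly p z.
have [rS vS] := regular_sum (index_enum _) (fun i => (Hmc i z (zs i)).1).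
have [_ vD] := regularD rp rS; rewrite {1}E vD vp vS; congr (_ + _).
by apply: eq_bigr => i _; case: (Hmc i z (zs i)).
Qed.

End PartialFractions.

(** * The polynomial of a fibre *)

Section Fibres.
Variable F : fieldType.
Variables (P : ratfun F) (t : F).
Implicit Types (f : ratfun F) (z : F).

(* Its roots are the finite points of the fibre of [P] over [t]. *)
Definition fibre_poly : {poly F} := rnum P - t *: rden P.

Lemma horner_fibre_poly z : fibre_poly.[z] = (rnum P).[z] - t * (rden P).[z].
Proof. by rewrite /fibre_poly !hornerE. Qed.

(** A common root with [rden P] would also be a root of [rnum P], against coprimality. *)
Lemma nroot_rden_fibre z : root fibre_poly z -> ~~ root (rden P) z.
Proof.
move=> Qz; apply/negP => dz; have nz : root (rnum P) z.
  move: Qz; rewrite rootE horner_fibre_poly.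
  by move: dz; rewrite rootE => /eqP ->; rewrite mulr0 subr0.
have /coprimep_root /(_ nz) := coprime_rnum_rden P.
by rewrite -rootE dz.
Qed.

Lemma root_fibre_poly z : root fibre_poly z <-> reval P (Some z) = Some t.
Proof.
split=> [Qz|].
  have dz := nroot_rden_fibre Qz; rewrite /= (negPf dz); congr Some.
  move: Qz; rewrite rootE horner_fibre_poly subr_eq0 => /eqP ->.
  by rewrite mulfK // -rootE.
rewrite /=; case: ifPn => // dz [E].
by rewrite rootE horner_fibre_poly -E divfK ?subrr // -rootE.
Qed.

Lemma invf_divB (x y c : F) : x != 0 -> x / (y - c * x) = (y / x - c)^-1.
Proof. by move=> x0; rewrite -[in RHS](mulfK x0 c) -mulrBl invf_div. Qed.

Lemma invr_rvalB z : ~~ root (rden P) z ->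
  (rval P (Some z) - t)^-1 = (rden P).[z] / fibre_poly.[z].
Proof.
move=> dz; rewrite /rval /= (negPf dz) /= horner_fibre_poly.
have d0 : (rden P).[z] != 0 by rewrite -rootE.
by rewrite invf_divB.
Qed.

(** The top coefficient can cancel only if the numerator has degree at most that of the denominator,
    and then exactly when [t] is the value at infinity. *)
Lemma size_fibre_poly : reval P None <> Some t -> size fibre_poly = (rdeg P).+1.
Proof.
move=> Pt; rewrite /rdeg /fibre_poly.
have d0 := rden_neq0 P; have sd : (0 < size (rden P))%N by rewrite size_poly_gt0.
rewrite prednK; last by rewrite leq_max sd orbT.
move: Pt; rewrite /=; case: ltnP => [lt _|le Pt].
  rewrite size_polyDl //.
  by rewrite size_polyN (leq_ltn_trans (size_scale_leq _ _)).
apply/eqP; rewrite eqn_leq; apply/andP; split.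
  rewrite (leq_trans (size_polyD _ _)) // geq_max le size_polyN.
  exact: size_scale_leq.
rewrite leqNgt; apply/negP; rewrite -(prednK sd) ltnS => /leq_sizeP /(_ _ (leqnn _)).
rewrite coefB coefZ -/(lead_coef _) => /eqP; rewrite subr_eq0 => /eqP E.
by apply: Pt; rewrite E mulfK // lead_coef_eq0.
Qed.

(** The source of the term in [1 / (P(oo) - t)]: the left side is the constant of the interpolation
    formula for [1 / (P - t)]. *)
Lemma coef_fibre_poly : reval P None <> Some t ->
  (rden P)`_(rdeg P) / fibre_poly`_(rdeg P) =
  match reval P None with Some c => (c - t)^-1 | None => 0 end.
Proof.
move=> Pt; have d0 := rden_neq0 P; rewrite /fibre_poly coefB coefZ /rdeg /=.
case: ltnP => [lt|le].
  rewrite [(rden P)`__]nth_default ?mul0r //.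
  by rewrite -ltnS prednK // (leq_trans _ lt).
rewrite -/(lead_coef _).
have l0 : lead_coef (rden P) != 0 by rewrite lead_coef_eq0.
exact: invf_divB.
Qed.

(** A multiple root would be a point of ramification greater than 1 lying over [t]. Non-constancy of
    [P] keeps the fibre polynomial nonzero, so that multiplicities make sense. *)
Lemma deriv_fibre_poly_neq0 z : (forall c, P <> rcst c) ->
  reval P (Some z) = Some t -> ~ branch_points P (Some t) ->
  fibre_poly^`().[z] != 0.
Proof.
move=> hP Pz nb; have Qz := (root_fibre_poly z).2 Pz.
have dz := nroot_rden_fibre Qz.
have Q0 : fibre_poly != 0.
  apply: contra_notN (hP t) => Q0; rewrite {1}[P]rnum_rden /rcst.
  have : rnum P = t *: rden P by apply/eqP; rewrite -subr_eq0.
  move=> ->; rewrite -mul_polyC tofracM mulfK // tofrac_eq0.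
  exact: rden_neq0.
apply: contra_notN nb => dQ; exists (Some z) => //=.
rewrite /ramification Pz /rord.
have E : P - rcst t = fibre_poly%:F / (rden P)%:F.
  rewrite {1}[P]rnum_rden /rcst /fibre_poly -mul_polyC tofracB tofracM mulrBl.
  by rewrite mulfK // tofrac_eq0 rden_neq0.
have rE : regular (P - rcst t) z.
  by apply/regularP; exists fibre_poly, (rden P).
have nz : ~~ root (rden (P - rcst t)) z.
  by move: rE; rewrite /regular /=; case: ifPn.
(* Neither denominator vanishes at [z], so cross-multiplication shows that [rnum (P - rcst t)] and
   [fibre_poly] have the same multiplicity there. *)
have cross : rnum (P - rcst t) * rden P = fibre_poly * rden (P - rcst t).
  apply/eqP; rewrite -tofrac_eq !tofracM -eqr_div ?tofrac_eq0 ?rden_neq0 //.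
  by rewrite -rnum_rden E.
have := congr1 (mup z) cross.
rewrite mupMl // mupMl // => ->; rewrite (mupNroot nz) subr0 ltz_nat.
rewrite mup_geq //.
have /factor_theorem[L LE] := Qz.
have : root L z.
  move: dQ; rewrite LE derivM derivXsubC !hornerE subrr mulr0 add0r.
  by rewrite rootE.
move=> /factor_theorem[L' L'E].
by rewrite LE L'E -mulrA -expr2 dvdp_mulIr.
Qed.

(** On the fibre [rnum P] equals [t] times [rden P], which reduces the quotient rule to the
    derivative of [fibre_poly] over [rden P]: the interpolation weight is [1 / P']. *)
Lemma rval_div_rderiv f z : regular f z -> root fibre_poly z ->
  fibre_poly^`().[z] != 0 ->
  rval (f / rderiv P) (Some z) =
  rval f (Some z) * ((rden P).[z] / fibre_poly^`().[z]).
Proof.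
move=> rf Qz dQ; have dz := nroot_rden_fibre Qz.
have d0 : (rden P).[z] != 0 by rewrite -rootE.
have d20 : ~~ root (rden P ^+ 2) z by rewrite rootE horner_exp expf_neq0.
have rP : regular (rderiv P) z.
  by apply/regularP; exists ((rnum P)^`() * rden P - rnum P * (rden P)^`()), (rden P ^+ 2).
have vP : rval (rderiv P) (Some z) = fibre_poly^`().[z] / (rden P).[z].
  rewrite /rderiv rval_frac // /fibre_poly derivB derivZ !hornerE.
  move: Qz; rewrite rootE horner_fibre_poly subr_eq0 => /eqP ->.
  by field.
have vP0 : rval (rderiv P) (Some z) != 0.
  by rewrite vP mulf_neq0 // invr_eq0.
have [rV vV] := regularV rP vP0.
by have [_ ->] := regularM rf rV; rewrite vV vP invf_div.
Qed.

End Fibres.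

(** * Points near the poles *)

Section PolynomialGrowth.
Variable C : numFieldType.
Implicit Types (A : {poly C}) (z : C).

(** The base [1 + |z|] is at least 1, so its top power dominates the lower ones for every [z], small
    or large. *)
Lemma horner_growth A : exists2 M : C, 0 <= M &
  forall z, `|A.[z]| <= M * (1 + `|z|) ^+ (size A).-1.
Proof.
exists (\sum_(k < size A) `|A`_k|); first exact: sumr_ge0.
move=> z; rewrite horner_coef (le_trans (ler_norm_sum _ _ _)) //.
rewrite mulr_suml ler_sum // => k _; rewrite normrM ler_wpM2l //.
have x1 : 1 <= 1 + `|z| by rewrite lerDl.
apply: (@le_trans _ _ ((1 + `|z|) ^+ k)).
  by rewrite normrX lerXn2r ?nnegrE ?addr_ge0 // lerDr.
rewrite ler_weXn2l // -ltnS prednK ?ltn_ord //.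
exact: leq_ltn_trans (ltn_ord k).
Qed.

Lemma prod_XsubC_growth (rs : seq C) (e : C -> C) : (forall b, 0 < e b) ->
  exists2 c : C, 0 < c & forall z, (forall b, b \in rs -> e b <= `|z - b|) ->
    c * (1 + `|z|) ^+ size rs <= `|(\prod_(b <- rs) ('X - b%:P)).[z]|.
Proof.
move=> e0; elim: rs => [|b rs [c c0 Hc]].
  by exists 1 => // z _; rewrite big_nil -polyC1 hornerC normr1 expr0 mulr1.
have d0 : 0 < 1 + `|b| + e b by rewrite addr_gt0 // ltr_wpDr.
(* The quotient [x / (1 + |b| + x)] increases with [x = |z - b| >= e b], and
   [1 + |z| <= 1 + |b| + x]; hence this factor bounds [|z - b| / (1 + |z|)] from below. *)
exists (e b / (1 + `|b| + e b) * c); first by rewrite !mulr_gt0 ?invr_gt0.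
move=> z Hz; rewrite big_cons hornerM hornerXsubC normrM exprS mulrACA.
apply: ler_pM => //.
- by rewrite mulr_ge0 ?addr_ge0 ?divr_ge0 // ltW.
- by rewrite mulr_ge0 ?exprn_ge0 ?addr_ge0 // ltW.
- have zb : 1 + `|z| <= 1 + `|b| + `|z - b|.
    have := ler_normD b (z - b); rewrite [b + _]addrC subrK => H.
    by rewrite -addrA lerD2l.
  rewrite mulrAC ler_pdivrMr //.
  apply: (@le_trans _ _ (e b * (1 + `|b| + `|z - b|))).
    by rewrite ler_wpM2l // ltW.
  rewrite [leLHS]mulrDr [leRHS]mulrDr [`|z - b| * e b]mulrC lerD2r.
  by rewrite ler_wpM2r ?addr_ge0 // Hz // mem_head.
- by apply: Hc => b' b'rs; apply: Hz; rewrite in_cons b'rs orbT.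
Qed.

End PolynomialGrowth.

Section PoleBound.
Variable C : numClosedFieldType.
Implicit Types (P : ratfun C) (z t : C).

(** By contraposition: outside the discs the growth estimates bound [|P(z)|] as soon as infinity is
    not a pole or [|z| <= K]. *)
Lemma rval_large_near_pole P (e : C -> C) (K : C) :
  (forall b, 0 < e b) -> 0 <= K ->
  exists2 M : C, 0 <= M & forall z t, reval P (Some z) = Some t -> M < `|t| ->
    (exists2 b, root (rden P) b & `|z - b| < e b) \/
    (size (rden P) < size (rnum P))%N /\ K < `|z|.
Proof.
move=> e0 K0; have [M M0 HA] := horner_growth (rnum P).
have [rs BE] := closed_field_poly_normal (rden P).
have l0 : lead_coef (rden P) != 0 by rewrite lead_coef_eq0 rden_neq0.
have sB : size (rden P) = (size rs).+1.
  by rewrite BE size_scale // size_prod_XsubC.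
have [c c0 HB] := prod_XsubC_growth rs e0.
pose c' := `|lead_coef (rden P)| * c.
have c'0 : 0 < c' by rewrite mulr_gt0 // normr_gt0.
(* One threshold for both cases: the power of [1 + K] is at least 1 if the degrees already give the
   bound, and it controls the numerator if [|z| <= K]. *)
exists (M / c' * (1 + K) ^+ (size (rnum P)).-1).
  by rewrite mulr_ge0 ?divr_ge0 ?exprn_ge0 ?addr_ge0 // ltW.
move=> z t Pz tM.
have [[b rb zb]|nb] := pselect (exists2 b, root (rden P) b & `|z - b| < e b).
  by left; exists b.
right; have far b : b \in rs -> e b <= `|z - b|.
  move=> brs; rewrite real_leNgt ?normr_real ?gtr0_real //; apply/negP => zb.
  by apply: nb; exists b => //; rewrite BE rootZ // root_prod_XsubC.
apply: contrapT => H; have Hx : (size (rnum P) <= size (rden P))%N \/ `|z| <= K.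
  have [|lt] := leqP (size (rnum P)) (size (rden P)); first by left.
  right; rewrite real_leNgt ?normr_real ?ger0_real //; apply/negP => Kz.
  exact: H.
suff : `|t| <= M / c' * (1 + K) ^+ (size (rnum P)).-1.
  by move=> /(lt_le_trans tM); rewrite ltxx.
have Bz : c' * (1 + `|z|) ^+ size rs <= `|(rden P).[z]|.
  by rewrite BE hornerZ normrM -mulrA ler_wpM2l // HB.
have x1 : 1 <= 1 + `|z| by rewrite lerDl.
have xgt0 : 0 < 1 + `|z| by rewrite (lt_le_trans ltr01).
have K1 : 1 <= 1 + K by rewrite lerDl.
have cx0 : 0 < c' * (1 + `|z|) ^+ size rs by rewrite mulr_gt0 ?exprn_gt0.
have -> : t = (rnum P).[z] / (rden P).[z].
  by move: Pz => /=; case: ifP => // _ [].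
rewrite normrM normfV ler_pdivrMr ?(lt_le_trans cx0) //.
apply: (le_trans (HA z)).
apply: (@le_trans _ _ (M / c' * (1 + K) ^+ (size (rnum P)).-1 *
    (c' * (1 + `|z|) ^+ size rs))); last first.
  by rewrite ler_wpM2l // mulr_ge0 ?divr_ge0 ?exprn_ge0 ?addr_ge0 // ltW.
have -> : M / c' * (1 + K) ^+ (size (rnum P)).-1 * (c' * (1 + `|z|) ^+ size rs) =
    M * ((1 + K) ^+ (size (rnum P)).-1 * (1 + `|z|) ^+ size rs).
  move: (_ ^+ _) (_ ^+ _) (lt0r_neq0 c'0) => x y nz.
  by rewrite mulrACA divfK // mulrA.
have xn_ge0 k : 0 <= (1 + `|z|) ^+ k by rewrite exprn_ge0 // ltW.
rewrite ler_wpM2l //; case: Hx => [le|zK].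
  rewrite -[leLHS]mul1r; apply: ler_pM => //; first exact: exprn_ege1.
  rewrite ler_weXn2l //; move: le; rewrite sB.
  by case: (size (rnum P)).
rewrite -[leLHS]mulr1; apply: ler_pM => //; last exact: exprn_ege1.
by rewrite lerXn2r ?nnegrE ?addr_ge0 ?lerD2l.
Qed.

End PoleBound.

(** * Counting simple roots *)

Section SimpleRoots.
Variable F : closedFieldType.

Lemma uniq_simple_roots (rs : seq F) :
  {in rs, forall b, (\prod_(b <- rs) ('X - b%:P))^`().[b] != 0} -> uniq rs.
Proof.
elim: rs => //= b rs IHrs H.
set S := \prod_(b <- rs) ('X - b%:P).
have dS x : (\prod_(b <- b :: rs) ('X - b%:P))^`().[x] =
    S.[x] + (x - b) * S^`().[x].
  by rewrite big_cons derivM derivXsubC !hornerE.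
apply/andP; split.
  have := H b (mem_head _ _); rewrite dS subrr mul0r addr0.
  by rewrite -rootE root_prod_XsubC.
apply: IHrs => x xrs; have : x \in b :: rs by rewrite in_cons xrs orbT.
move=> /H; rewrite dS; have : root S x by rewrite root_prod_XsubC.
by rewrite rootE => /eqP ->; rewrite add0r mulf_eq0 negb_or => /andP[].
Qed.

(** Pigeonhole: simple roots make exactly [n] distinct points, and [n] values covering them cannot
    repeat. *)
Lemma enumeration_simple_roots_inj n (Q : {poly F}) (p : 'I_n -> F) :
  size Q = n.+1 -> (forall z, root Q z -> Q^`().[z] != 0) ->
  (forall z, root Q z -> exists i, p i = z) -> injective p.
Proof.
move=> sQ dQ surj; have [rs QE] := closed_field_poly_normal Q.
have l0 : lead_coef Q != 0 by rewrite lead_coef_eq0 -size_poly_gt0 sQ.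
have rsQ b : b \in rs -> root Q b.
  by move=> brs; rewrite QE rootZ // root_prod_XsubC.
have urs : uniq rs.
  apply: uniq_simple_roots => b /rsQ /dQ.
  by rewrite {1}QE derivZ hornerZ mulf_eq0 negb_or => /andP[].
have szrs : size rs = n.
  by have := sQ; rewrite QE size_scale // size_prod_XsubC => -[].
apply/injectiveP; apply: (leq_size_uniq urs).
  move=> b /rsQ /surj [i <-]; exact: codom_f.
by rewrite size_codom card_ord szrs.
Qed.

End SimpleRoots.

(** * Neighbourhoods of poles with constant winding number *)

Section PoleNeighbourhoods.
Variable R : realType.
Variable gamma : R -> R[i].
Hypothesis gamma_pws : piecewise_smooth gamma.
Hypothesis gamma_closed : gamma 0 = gamma 1.
Implicit Types (a w : R[i]) (D : set (CP1 R)).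

Lemma normc_sqnorm (z : R[i]) : `|z| = (Num.sqrt (sqnorm z))%:C.
Proof. exact: normc_def. Qed.

Lemma curve_away_from a : (forall u, u \in `[0, 1] -> gamma u != a) ->
  exists2 d : R[i], 0 < d & forall u, u \in `[0, 1] -> d <= `|gamma u - a|.
Proof.
move=> ga; have cs : {within `[0, 1], continuous (fun u => sqnorm (gamma u - a))}.
  apply: (within_sqnorm (g := fun u => gamma u - a)).
  have [cg _] := gamma_pws.
  by move=> x; apply: cvgD; [exact: cg | exact: cvg_cst].
have [c c01 Hc] := EVT_min ler01 cs.
exists `|gamma c - a|; first by rewrite normr_gt0 subr_eq0 ga.
by move=> u /Hc le; rewrite !normc_sqnorm lecR ler_wsqrtr.
Qed.

Lemma curve_bounded : exists2 K : R[i], 0 <= K &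
  forall u, u \in `[0, 1] -> `|gamma u| <= K.
Proof.
have [cg _] := gamma_pws; have [c c01 Hc] := EVT_max ler01 (within_sqnorm cg).
exists `|gamma c| => // u /Hc le.
by rewrite !normc_sqnorm lecR ler_wsqrtr.
Qed.

(** Neighbourhoods of infinity on the sphere are given by compact sets; this turns them into
    radii. *)
Lemma compact_normc_bounded (W : set R[i]) : compact W ->
  exists2 K : R[i], 0 <= K & forall w, W w -> `|w| <= K.
Proof.
move=> cW.
have bnd (f : R[i] -> R) : continuous f ->
    exists K : R, forall w, W w -> `|f w| <= K.
  move=> cf; have : compact (f @` W).
    by apply: continuous_compact => //; exact: continuous_subspaceT.
  move=> /(@compact_bounded R R) [K [Kr HK]]; exists (K + 1) => w Ww.
  by apply: (HK (K + 1)); [rewrite ltrDl | exists w].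
have [K1 H1] := bnd _ (@Re_continuous R); have [K2 H2] := bnd _ (@Im_continuous R).
exists (Num.sqrt (K1 ^+ 2 + K2 ^+ 2))%:C; first by rewrite ler0c sqrtr_ge0.
move=> w Ww; rewrite normc_sqnorm lecR ler_wsqrtr // /sqnorm.
by apply: lerD; rewrite -real_normK ?num_real // lerXn2r ?nnegrE ?H1 ?H2 //;
  apply: le_trans (normr_ge0 _) _; [exact: (H1 w) | exact: (H2 w)].
Qed.

Lemma winding_finite_pole_nbhs a D : nbhs (Some a : CP1 R) D ->
  (forall u, u \in `[0, 1] -> gamma u != a) ->
  exists2 d : R[i], 0 < d & forall w, `|w - a| < d ->
    D (Some w) /\ winding gamma (Some w) = winding gamma (Some a).
Proof.
move=> nD ga; have [d d0 Hd] := curve_away_from ga.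
have : nbhs a [set w | D (Some w)] by exact: nD.
move=> /nbhs_ballP[e /= e0 He]; have ed : (e >=< d)%O by rewrite real_comparable ?gtr0_real.
exists (Num.min e d); first by rewrite comparable_lt_min // e0.
move=> w; rewrite comparable_lt_min // => /andP[we wd]; split.
  by apply: He; rewrite -ball_normE /= distrC.
by apply: winding_near => // u /Hd; exact: lt_le_trans.
Qed.

Lemma winding_infinity_nbhs D : nbhs (None : CP1 R) D ->
  exists2 K : R[i], 0 <= K & forall w, K < `|w| ->
    D (Some w) /\ winding gamma (Some w) = 0.
Proof.
move=> [W [cW _] WD].
have [K1 K10 H1] := compact_normc_bounded cW; have [K2 K20 H2] := curve_bounded.
(* [K1] clears the compact complement of the neighbourhood, [K2] clears the curve. *)
exists (K1 + K2); first exact: addr_ge0.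
move=> w Kw; split.
  apply: WD; left; exists w => // Ww.
  have := le_lt_trans (H1 _ Ww) (le_lt_trans _ Kw).
  by move=> /(_ _); rewrite ltxx lerDl => /(_ K20).
apply: winding_far => // u /H2 le; apply: (le_lt_trans le).
by apply: le_lt_trans Kw; rewrite lerDr.
Qed.

End PoleNeighbourhoods.

(** * The formula near infinity *)

(** Membership in [D e] and equality of winding numbers must concern the same pole, so each radius
    is chosen to ensure both. *)
Lemma fibre_near_poles (R : realType) (P : ratfun R[i]) (gamma : R -> R[i])
    (r : nat) (zP : 'I_r -> CP1 R) (D : 'I_r -> set (CP1 R)) :
  piecewise_smooth gamma -> gamma 0 = gamma 1 ->
  (forall u : R, u \in `[0, 1] -> ~ rpoles P (Some (gamma u))) ->
  range zP = rpoles P -> (forall e, nbhs (zP e) (D e)) ->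
  exists2 M : R[i], 0 <= M & forall z t, reval P (Some z) = Some t -> M < `|t| ->
    exists e, D e (Some z) /\ winding gamma (Some z) = winding gamma (zP e).
Proof.
move=> pws clo gP hzP hD.
(* A radius is attached to every [b], with the dummy value 1 when [b] is not a pole, so that
   [choice] yields a function. *)
have Hfin b : exists d : R[i], 0 < d /\ (root (rden P) b ->
    forall w, `|w - b| < d -> exists e, D e (Some w) /\
      winding gamma (Some w) = winding gamma (zP e)).
  have [rb|nrb] := boolP (root (rden P) b); last by exists 1.
  have : rpoles P (Some b) by rewrite /rpoles /= rb.
  rewrite -hzP => -[e _ zPe].
  have gb u : u \in `[0, 1] -> gamma u != b.
    by move=> u01; apply: contra_notN (gP u u01) => /eqP ->; rewrite -zPe -hzP; exists e.
  have nD := hD e; rewrite zPe in nD.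
  have [d d0 Hd] := winding_finite_pole_nbhs pws clo nD gb.
  by exists d; split=> // _ w /Hd ?; exists e; rewrite zPe.
have [d Hd] := choice Hfin.
have [K K0 HK] : exists2 K : R[i], 0 <= K & (size (rden P) < size (rnum P))%N ->
    forall w, K < `|w| -> exists e, D e (Some w) /\
      winding gamma (Some w) = winding gamma (zP e).
  have [lt|ge] := ltnP (size (rden P)) (size (rnum P)); last by exists 0.
  have : rpoles P None by rewrite /rpoles /= lt.
  rewrite -hzP => -[e _ zPe].
  have nD := hD e; rewrite zPe in nD.
  have [K K0 HK] := winding_infinity_nbhs pws clo nD.
  by exists K => // _ w /HK ?; exists e; rewrite zPe.
have [M M0 HM] := rval_large_near_pole P (fun b => (Hd b).1) K0.
exists M => // z t Pz tM; have [[b rb zb]|[lt Kz]] := HM z t Pz tM.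
  exact: (Hd b).2 rb z zb.
exact: HK.
Qed.

(** A sum of moduli dominates each of them. A pole contributes 0 and cannot have the finite value
    [t]; allowing points of the sphere covers infinity too. *)
Lemma near_infinity_regular (R : realType) (P : ratfun R[i]) (l : nat)
    (z : 'I_l -> CP1 R) :
  exists2 M : R[i], 0 <= M & forall t, M < `|t| -> forall s, reval P (z s) <> Some t.
Proof.
exists (\sum_(s < l) `|rval P (z s)|); first exact: sumr_ge0.
move=> t tM s Ps; move: tM; rewrite (bigD1 s) //= /rval Ps /=.
by rewrite gtrDl le_gtF ?sumr_ge0.
Qed.

Theorem theorem2p1 (R : realType) (P q : ratfun R[i]) (n : nat)
    (hP : forall c : R[i], P <> rcst c) (hn : rdeg P = n) (hq : q <> 0)
    (gamma : R -> R[i]) (hgamma : closed_curve gamma)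
    (hgP : forall u : R, u \in `[0, 1] -> ~ rpoles P (Some (gamma u)))
    (hgq : forall u : R, u \in `[0, 1] -> ~ rpoles q (Some (gamma u)))
    (U : set R[i]) (hU : simply_connected_domain U)
    (hUbranch : (Some @` U : set (CP1 R)) `&` branch_points P = set0)
    (hUinfty : boundary (Some @` U : set (CP1 R)) None)
    (Pinv : 'I_n -> R[i] -> CP1 R) (hPinv : inverse_branches P U Pinv)
    (r : nat) (zP : 'I_r -> CP1 R)
    (zP_inj : injective zP) (hzP : range zP = rpoles P)
    (D : 'I_r -> set (CP1 R)) (hD : forall e, nbhs (zP e) (D e))
    (hDdisj : forall e e', e != e' -> D e `&` D e' = set0)
    (l : nat) (zq : 'I_l -> R[i])
    (zq_inj : injective zq) (hzq : range zq = [set z | rpoles q (Some z)]) :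
  exists M : R, forall t : R[i],
    U t -> U_infty P gamma (Some t) -> M%:C < `|t| ->
    I_infty P q gamma t =
      \sum_(e < r) winding gamma (zP e) *
        (\sum_(i < n | Pinv i t \in D e) rval (q / rderiv P) (Pinv i t))
      - \sum_(s < l) winding gamma (Some (zq s)) *
          psi P (principal_part q (zq s)) Pinv t
      + match reval P None with
        | Some c => (two_pi_i R)^-1 * (c - t)^-1 *
                    contour_integral gamma (fun z => rval q (Some z))
        | None => 0
        end.
Proof.
have [pws _ clo] := hgamma.
have [M1 M10 HM1] := fibre_near_poles pws clo hgP hzP hD.
have [M2 M20 HM2] := near_infinity_regular P (fun s => Some (zq s) : CP1 R).
have [M3 M30 HM3] := near_infinity_regular P (fun _ : 'I_1 => None : CP1 R).
have q_poles z : ~ regular q z -> exists s, zq s = z.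
  move=> /contrapT nr; have : range zq z by rewrite hzq.
  by move=> [s _ <-]; exists s.
have [pol [m [c [ppE qE]]]] := rval_expansion zq_inj q_poles.
(* [M1] brings the fibre near the poles of [P], [M2] keeps it off the poles of [q], and [M3]
   separates [t] from the value of [P] at infinity. *)
set Msum := M1 + M2 + M3.
have Msum0 : 0 <= Msum by rewrite !addr_ge0.
exists (complex.Re Msum) => t Ut tU tM.
have MsumE : (complex.Re Msum)%:C = Msum by rewrite RRe_real // ger0_real.
rewrite MsumE in tM.
have t1 : M1 < `|t| by apply: le_lt_trans tM; rewrite /Msum -addrA lerDl addr_ge0.
have t2 s : reval P (Some (zq s)) <> Some t.
  by apply: HM2; apply: le_lt_trans tM; rewrite /Msum addrAC lerDr addr_ge0.
have t3 : reval P None <> Some t.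
  by apply: (HM3 _ _ ord0); apply: le_lt_trans tM; rewrite /Msum lerDr addr_ge0.
have gt u : u \in `[0, 1] -> reval P (Some (gamma u)) <> Some t.
  by move=> u01 E; apply: (connected_component_sub tU); exists u.
have nbranch : ~ branch_points P (Some t).
  move=> bt; have : ((Some @` U : set (CP1 R)) `&` branch_points P) (Some t).
    by split=> //; exists t.
  by rewrite hUbranch.
have [_ fibreE] := hPinv t Ut.
have PinvE i : reval P (Pinv i t) = Some t.
  have : range (Pinv ^~ t) (Pinv i t) by exists i.
  by rewrite -fibreE.
(* No branch is at infinity, since [t] is not [P(oo)]. *)
have [p pE] : exists p : 'I_n -> R[i], forall i, Pinv i t = Some (p i).
  exists (fun i => odflt 0 (Pinv i t)) => i.
  by have := PinvE i; case: (Pinv i t) => [//|/t3].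
pose Q := fibre_poly P t.
have rP i : reval P (Some (p i)) = Some t by rewrite -pE.
have rQ i : root Q (p i) by apply/root_fibre_poly.
have sQ : size Q = n.+1 by rewrite -hn; exact: size_fibre_poly.
have dQ z : root Q z -> Q^`().[z] != 0.
  by move=> /root_fibre_poly Pz; exact: deriv_fibre_poly_neq0.
have p_surj z : root Q z -> exists i, p i = z.
  move=> /root_fibre_poly Pz; have : range (Pinv ^~ t) (Some z) by rewrite -fibreE.
  by move=> [i _]; rewrite pE => -[]; exists i.
have p_inj := enumeration_simple_roots_inj sQ dQ p_surj.
have gp i u : u \in `[0, 1] -> gamma u != p i.
  by move=> u01; apply/eqP => E; apply: (gt u u01); rewrite E.
have pzq i s : p i != zq s.
  by apply/eqP => E; apply: (t2 s); rewrite -E.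
have gzq s u : u \in `[0, 1] -> gamma u != zq s.
  move=> u01; apply/eqP => E; apply: (hgq u u01).
  by have : range zq (gamma u) by [exists s]; rewrite hzq.
(* An explicit substitute for [q], equal to it along the curve and on the fibre, to which the
   integral formulas apply. *)
pose E := partial_fraction_sum (size pol) (fun k => pol`_k) zq m c.
have EE z : (forall s, z != zq s) -> rval q (Some z) = E z.
  by move=> zs; rewrite qE // horner_coef.
pose al i := (rden P).[p i] / Q^`().[p i].
pose k := (rden P)`_n / Q`_n.
have kE : k = match reval P None with Some c => (c - t)^-1 | None => 0 end.
  by rewrite /k -hn coef_fibre_poly.
have valE f i : regular f (p i) ->
    rval (f / rderiv P) (Pinv i t) = rval f (Some (p i)) * al i.
  by move=> rf; rewrite pE; apply: rval_div_rderiv => //; exact: dQ.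
have rq i : regular q (p i).
  by apply: contrapT => /q_poles[s E']; have := pzq i s; rewrite E' eqxx.
have rqs s i : regular (principal_part q (zq s)) (p i).
  by have [m' [c' H]] := principal_part_expansion q (zq s); case: (H _ (pzq i s)).
have IE : I_infty P q gamma t = (two_pi_i R)^-1 * (k * contour_integral gamma E +
    \sum_(i < n) al i * (E (p i) * contour_integral gamma (fun z => (z - p i)^-1) -
      \sum_(s < l) polar zq m c s (p i) *
         contour_integral gamma (fun z => (z - zq s)^-1))).
  rewrite /I_infty; congr (_ * _).
  rewrite -(contour_integral_partial_fractions_sum pws clo _ _ _ _ gzq _ _ gp pzq).
  apply: eq_contour_integral => u u01.
  have dg : ~~ root (rden P) (gamma u).
    by apply/negP => rg; apply: (hgP u u01); rewrite /rpoles /= rg.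
  rewrite EE ?invr_rvalB //; last by move=> s; exact: gzq.
  congr (_ * _); apply: lagrange_partial_fractions => //.
  - rewrite -hn /rdeg prednK ?leq_maxr //.
    by rewrite leq_max !size_poly_gt0 rden_neq0 orbT.
  - by move=> i; exact: dQ.
  - by apply/negP => /root_fibre_poly; exact: gt.
(* Disjointness leaves exactly one [e] with the branch in [D e], so for fixed [i] the sum over [e]
   reduces to a single winding number. *)
have sumD i : \sum_(e < r | Pinv i t \in D e) winding gamma (zP e) =
    winding gamma (Some (p i)).
  have [e [De ->]] := HM1 _ _ (rP i) t1.
  rewrite (bigD1 e) /=; last by rewrite inE pE.
  rewrite big1 ?addr0 // => e' /andP[]; rewrite inE pE => De' ne.
  by have : (D e' `&` D e) (Some (p i)) by []; rewrite hDdisj.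
rewrite IE kE.
(* Both double sums are regrouped by fibre point, to be compared with the integral one [i] at a
   time. *)
have -> : \sum_(e < r) winding gamma (zP e) *
    (\sum_(i < n | Pinv i t \in D e) rval (q / rderiv P) (Pinv i t)) =
    \sum_(i < n) winding gamma (Some (p i)) * (E (p i) * al i).
  under eq_bigr do rewrite mulr_sumr big_mkcond.
  rewrite exchange_big; apply: eq_bigr => i _; rewrite -big_mkcond /= -mulr_suml.
  by rewrite sumD valE // EE.
have -> : \sum_(s < l) winding gamma (Some (zq s)) *
    psi P (principal_part q (zq s)) Pinv t =
    \sum_(i < n) \sum_(s < l) winding gamma (Some (zq s)) *
      (polar zq m c s (p i) * al i).
  rewrite exchange_big; apply: eq_bigr => s _; rewrite /psi mulr_sumr.
  by apply: eq_bigr => i _; rewrite valE // ppE.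
rewrite mulrDr addrC; congr (_ + _); last first.
  rewrite (eq_contour_integral (g := fun z => rval q (Some z))); last first.
    by move=> u u01; rewrite EE // => s; exact: gzq.
  by case: (reval P None) => [v|]; rewrite ?mul0r ?mulr0 // mulrA.
rewrite -sumrB mulr_sumr; apply: eq_bigr => i _.
rewrite mulrBr mulrBr; congr (_ - _); first by rewrite /winding; ring.
rewrite !mulr_sumr; apply: eq_bigr => s _.
by rewrite /winding; ring.
Qed.
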